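(* Let $\mathcal{A}$ be a class of measurable subsets of $\mathcal{X}$ and $S=\{\mathbb{1}_A: A\in\mathcal{A}\}$. Assume that $S$ satisfies the separability condition (M) and that $\mathcal{A}$ is a VC-class with dimension $V\ge1$. There exists an absolute constant $C$ such that, if $\hat s$ denotes an empirical risk minimizer over $S$ and if the Bayes classifier $s^*$ belongs to $S$, the following inequality holds: $$\mathbb{E}[\ell(s^*,\hat s)]\le C\sqrt{\frac{V\wedge(1\vee\mathbb{E}[H_{\mathcal{A}}])}{n}}.$$ Moreover, if $\theta\ge1$ is given and one assumes that the margin condition $$\ell(s^*,t)\ge h^\theta\,\|s^*-t\|_1^{\theta}\qquad\text{for every }t\in S$$ holds with $h\in(0,1]$ satisfying $h\ge(V/n)^{1/(2\theta)}$, then the following inequalities also hold: $$\mathbb{E}[\ell(s^*,\hat s)]\le C\left(\frac{1\vee\mathbb{E}[H_{\mathcal{A}}]}{nh}\right)^{\theta/(2\theta-1)}$$ and $$\mathbb{E}[\ell(s^*,\hat s)]\le C\left(\frac{V\,(1+\log(nh^{2\theta}/V))}{nh}\right)^{\theta/(2\theta-1)}.$$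
   Context: Binary classification setting: $(X_1,Y_1),\dots,(X_n,Y_n)$ are $n$ independent copies of a pair $(X,Y)$ with joint distribution $P$, where $X$ takes values in a measurable space $\mathcal{X}$ and $Y\in\{0,1\}$. A classifier is a measurable map $t:\mathcal{X}\to\{0,1\}$. $\eta(x)=P[Y=1\mid X=x]$ is the regression function, and $s^*(x)=\mathbb{1}_{\eta(x)\ge1/2}$ is the Bayes classifier. The relative loss is $\ell(s^*,t)=P(Y\ne t(X))-P(Y\ne s^*(X))$. $\mu$ is the marginal distribution of $X$ and $\|\cdot\|_1$ is the $\mathbb{L}_1(\mu)$-norm. An empirical risk minimizer over $S$ is an estimator (measurable function of the sample) with values in $S$ which minimizes $\gamma_n(t)=n^{-1}\sum_{i=1}^n\mathbb{1}_{Y_i\ne t(X_i)}$ over $t\in S$. Condition (M): there exists a countable subset $S'$ of $S$ such that, for every $t\in S$, there is a sequence $(t_k)$ in $S'$ such that, for every $(x,y)\in\mathcal{X}\times\{0,1\}$, $\mathbb{1}_{y\ne t_k(x)}\to\mathbb{1}_{y\ne t(x)}$ as $k\to\infty$. VC-dimension: with $m_{\mathcal{A}}(N)$ the supremum of $\#\{A\cap C: A\in\mathcal{A}\}$ over subsets $C\subset\mathcal{X}$ of cardinality $N$, $V=\sup\{N: m_{\mathcal{A}}(N)=2^N\}$, and $\mathcal{A}$ is a VC-class if $V<\infty$. Random combinatorial entropy: $H_{\mathcal{A}}=\log\#\{A\cap\{X_1,\dots,X_n\}: A\in\mathcal{A}\}$. $a\wedge b=\min(a,b)$, $a\vee b=\max(a,b)$.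 An absolute constant is a numerical constant depending on no other quantity. *)

(* Defs.v *)
From HB Require Import structures.
From mathcomp Require Import all_boot all_order all_algebra.
From mathcomp Require Import finmap.
From mathcomp Require Import all_classical all_reals all_analysis.

Set Implicit Arguments.
Unset Strict Implicit.
Unset Printing Implicit Defensive.

Import Order.TTheory GRing.Theory Num.Theory.
Import numFieldNormedType.Exports.

Local Open Scope classical_set_scope.
Local Open Scope ring_scope.

(* Labels {0,1} are encoded by bool, and classifiers by maps X -> bool. *)

HB.instance Definition _ d1 d2 (T1 : measurableType d1)
    (T2 : measurableType d2) :=
  isMeasurableFun.Build _ _ (T1 * T2)%type T1 fst measurable_fst.

Definition marginal {d} {X : measurableType d} {R : realType}
    (P : probability (X * bool)%type R) : probability X R :=
  distribution P (fst : {mfun (X * bool)%type >-> X}).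

(* eta is a version of x |-> P[Y = 1 | X = x]. *)
Definition regression_function {d} {X : measurableType d} {R : realType}
    (P : probability (X * bool)%type R) (eta : X -> R) : Prop :=
  (marginal P).-integrable setT (EFin \o eta) /\
  forall A : set X, measurable A ->
    (\int[marginal P]_(x in A) (eta x)%:E = P (A `*` [set true]))%E.

Definition bayes_classifier {X : Type} {R : realType} (eta : X -> R)
    : X -> bool :=
  fun x => 2^-1 <= eta x.

Definition risk {d} {X : measurableType d} {R : realType}
    (P : probability (X * bool)%type R) (t : X -> bool) : R :=
  fine (P [set z | z.2 != t z.1]).

Definition relative_loss {d} {X : measurableType d} {R : realType}
    (P : probability (X * bool)%type R) (s t : X -> bool) : R :=
  risk P t - risk P s.

Definition L1_dist {d} {X : measurableType d} {R : realType}
    (P : probability (X * bool)%type R) (s t : X -> bool) : R :=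
  fine (Lnorm (marginal P) 1%:E (fun x => ((s x)%:R - (t x)%:R)%:E)).

Definition indicators {X : Type} (A : set (set X)) : set (X -> bool) :=
  [set (fun x => x \in B) | B in A].

Definition separable_class {X : Type} (R : realType) (S : set (X -> bool))
    : Prop :=
  exists S' : set (X -> bool), [/\ S' `<=` S, countable S' &
    forall t, S t -> exists2 u : nat -> X -> bool, (forall k, S' (u k)) &
      forall (x : X) (y : bool),
        (fun k => (y != u k x)%:R : R) @ \oo --> ((y != t x)%:R : R)].

(* #{A `&` C : A in the class}; meaningful for finite C, as fset_set of an
   infinite set is empty. *)
Definition trace_card {X : Type} (A : set (set X)) (C : set X) : nat :=
  #|` fset_set [set B `&` C | B in A]|%N.

(* The supremum over the empty set (when X has fewer than N points) is 0. *)
Definition growth_function {X : Type} (A : set (set X)) (N : nat) : nat :=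
  supremum 0%N [set trace_card A C | C in [set C : set X | C #= `I_N]%card].

(* V is the supremum in nat of {N | m_A(N) = 2 ^ N}; in particular this set is
   bounded, i.e., A is a VC-class. *)
Definition vc_dimension {X : Type} (A : set (set X)) (V : nat) : Prop :=
  supremums [set N | growth_function A N = (2 ^ N)%N] V.

Definition combinatorial_entropy {X : Type} (R : realType) {n : nat}
    (A : set (set X)) (x : 'I_n -> X) : R :=
  ln (trace_card A (range x))%:R.

Definition iid_copies {d0 d} {Omega : measurableType d0}
    {T : measurableType d} {R : realType} (Pr : probability Omega R)
    (P : probability T R) {n : nat} (Z : 'I_n -> {RV Pr >-> T}) : Prop :=
  (forall i (B : set T), measurable B -> Pr (Z i @^-1` B) = P B) /\
  (forall (J : {set 'I_n}) (B : 'I_n -> set T),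
     (forall i, i \in J -> measurable (B i)) ->
     Pr (\bigcap_(i in [set` J]) (Z i @^-1` B i)) =
     (\prod_(i in J) Pr (Z i @^-1` B i))%E).

Definition empirical_risk {X : Type} (R : realType) {n : nat}
    (z : n.-tuple (X * bool)) (t : X -> bool) : R :=
  n%:R^-1 * \sum_(i < n) ((tnth z i).2 != t (tnth z i).1)%:R.

(* Measurability of a function-valued statistic is understood jointly in the
   sample and in the point at which the classifier is evaluated. *)
Definition empirical_risk_minimizer {d} {X : measurableType d} (R : realType)
    {n : nat} (S : set (X -> bool))
    (shat : n.-tuple (X * bool)%type -> X -> bool) : Prop :=
  [/\ measurable_fun setT
        (fun p : n.-tuple (X * bool)%type * X => shat p.1 p.2),
      forall z, S (shat z) &
      forall z t, S t -> empirical_risk R z (shat z) <= empirical_risk R z t].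

(* Main.v *)
(** Neither the concentration inequality nor the peeling of the usual proof is
    needed.  Write [l] for the relative loss of a classifier [t] and [g] for
    the indicator of [t <> sstar].  Since [sstar] belongs to the class, the
    empirical excess risk of the minimizer is nonpositive, so
    [4 l - 2 c P g] is at most [4 (P - P_n) (excess) - 2 c P g].  A ghost sample
    and random swaps turn the right-hand side into Rademacher sums carrying the
    negative offset [- c] at each point where [t <> sstar].  The offset absorbs
    the variance: for finitely many traces, [lambda] times the offset sum has
    exponential moment at most 1 when [lambda] is of order [c], which gives
    [log (number of traces) / c].  For a VC-class, chaining with the offset
    [c 2 ^ k] at the Hamming scale [V / c ^ 2 / 4 ^ k], with nets whose
    cardinality is bounded by the probabilistic extraction argument and the
    Sauer-Shelah lemma, gives [V (1 + log (n c ^ 2 / V)) / c].  The slow rates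
    follow by taking [c] equal to the rate, and under the margin condition
    [c = h r ^ (1 - 1 / theta)], with [r] the announced rate, satisfies
    [c P g <= l + r]. *)

Require Import Defs.
From HB Require Import structures.
From mathcomp Require Import all_boot all_order all_algebra.
From mathcomp Require Import all_classical all_reals all_analysis.
From mathcomp Require Import measurable_realfun ring lra.
Import Order.TTheory GRing.Theory Num.Theory.
Import numFieldNormedType.Exports.
Set Implicit Arguments.
Unset Strict Implicit.
Unset Printing Implicit Defensive.
Local Open Scope ring_scope.

(** * Shattering and packing *)

Definition shatters (T : finType) (F : {set {set T}}) (A : {set T}) : bool :=
  [forall B : {set T}, (B \subset A) ==> [exists C in F, A :&: C == B]].

Lemma shattersP (T : finType) (F : {set {set T}}) (A : {set T}) :
  reflect (forall B : {set T}, B \subset A -> exists2 C, C \in F & A :&: C = B)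
          (shatters F A).
Proof.
apply: (iffP forallP) => h B; last first.
  by apply/implyP => /h[C CF eAC]; apply/existsP; exists C; rewrite CF eAC eqxx.
by move=> BA; move: (h B); rewrite BA => /existsP[C /andP[CF /eqP eAC]]; exists C.
Qed.

Lemma shattersS (T : finType) (F G : {set {set T}}) (A : {set T}) :
  F \subset G -> shatters F A -> shatters G A.
Proof.
move=> /fintype.subsetP FG /shattersP h; apply/shattersP => B /h[C CF eAC].
by exists C => //; exact: FG.
Qed.

(* Pajor's form of the Sauer-Shelah lemma. *)
Lemma card_shatters (T : finType) (F : {set {set T}}) :
  (#|F| <= #|[set A | shatters F A]|)%N.
Proof.
have [k] := ubnP #|F|; elim: k F => // k IH F.
rewrite ltnS => leFk.
have [F1|] := leqP #|F| 1.
  case: (set_0Vmem F) => [->|[C CF]]; first by rewrite cards0.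
  apply: leq_trans F1 _; apply/card_gt0P; exists finset.set0; rewrite inE.
  by apply/shattersP => B; rewrite finset.subset0 => /eqP->; exists C; rewrite ?finset.set0I.
move=> /card_gt1P[C1 [C2 [C1F C2F C12]]].
(* Induction on the size of the family: it is split by membership of a point [x] that separates two
   of its members, so both halves are strictly smaller. *)
have [x xC] : exists x, (x \in C1) != (x \in C2).
  apply/existsP; rewrite -negb_forall; apply: contra C12 => /forallP h.
  by apply/eqP/setP => x; apply/eqP; exact: h.
pose G b := [set C in F | (x \in C) == b].
have GF b : G b \subset F by apply/fintype.subsetP => C; rewrite inE => /andP[].
have ltG b : (#|G b| < k)%N.
  apply: leq_trans leFk; apply: proper_card; rewrite properE GF /=.
  apply/negP => /fintype.subsetP FG; move: (FG _ C1F) (FG _ C2F).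
  by rewrite !inE C1F C2F /= => /eqP e1 /eqP e2; rewrite e1 e2 eqxx in xC.
pose S b := [set A | shatters (G b) A].
(* All members of a half agree at [x], so no set containing [x] is shattered by it. *)
have xS b A : A \in S b -> x \notin A.
  rewrite inE => /shattersP h; apply/negP => xA.
  have [C] := h (if b then finset.set0 else A) (ltac:(by case: (b); rewrite ?finset.sub0set)).
  rewrite inE => /andP[_ /eqP xCb] /setP/(_ x); rewrite finset.in_setI xA xCb /=.
  by case: (b); rewrite ?inE ?xA.
have cardF : #|F| = (#|G true| + #|G false|)%N.
  rewrite -cardsUI [X in (_ + X)%N](_ : _ = 0%N) ?addn0; last first.
    apply/eqP; rewrite cards_eq0; apply/eqP/setP => C; rewrite !inE.
    by case: (C \in F) (x \in C) => [] [].
  apply/esym; congr #|pred_of_set _|; apply/setP => C.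
  by rewrite !inE; case: (C \in F) (x \in C) => [] [].
rewrite cardF; apply: (leq_trans (leq_add (IH _ (ltG true)) (IH _ (ltG false)))).
rewrite -/(S true) -/(S false) -cardsUI.
(* A set [A] shattered by both halves is counted twice; the second count is charged to [x |: A],
   which the whole family shatters: one half is picked to decide [x] and realizes the rest. *)
have injx : {in S true :&: S false &, injective (fun A => x |: A)}.
  move=> A B; rewrite !finset.in_setI => /andP[/xS xA _] /andP[/xS xB _] e.
  by rewrite -(setU1K xA) e setU1K.
rewrite -(card_in_imset injx) -cardsUI [X in (_ + X)%N](_ : _ = 0%N) ?addn0; last first.
  apply/eqP; rewrite cards_eq0; apply/eqP/setP => A; rewrite [RHS]inE.
  apply/negP; rewrite finset.in_setI => /andP[SA /imsetP[B _ eA]].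
  have : x \notin A by move: SA; rewrite finset.in_setU => /orP[] /xS.
  by rewrite eA setU11.
apply: subset_leq_card; apply/fintype.subsetP => A; rewrite !inE.
case/orP; first by case/orP; exact: shattersS.
move=> /imsetP[B]; rewrite !inE => /andP[/[dup] h1 /shattersP hB1 /shattersP hB0] ->{A}.
have xB : x \notin B by apply: (xS true); rewrite inE.
apply/shattersP => D DB.
have DxB : D :\ x \subset B by rewrite subDset.
have [b xD] : exists b, (x \in D) = b by exists (x \in D).
have [C] : exists2 C, C \in G b & B :&: C = D :\ x by case: b {xD}; [exact: hB1|exact: hB0].
rewrite inE => /andP[CF /eqP xCb] eBC; exists C => //.
apply/setP => y; rewrite !inE; have [->|yx] := eqVneq y x; first by rewrite /= xCb.
by move/setP/(_ y): eBC; rewrite !inE yx.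
Qed.

(** Two points of [B] with the same image under [f] could not be separated by a preimage, so [f] is
    injective on [B]. Hence resampling points does not raise the VC bound. *)
Lemma shatters_preim (I J : finType) (f : J -> I) (F : {set {set I}})
    (B : {set J}) :
  shatters [set f @^-1: (A : {set I}) | A : {set I} in F] B ->
  shatters F (f @: B) /\ #|f @: B| = #|B|.
Proof.
move=> /shattersP h; split.
  apply/shattersP => D DB.
  have [_ /imsetP[C CF ->] eBC] := h (B :&: f @^-1: D) (finset.subsetIl _ _).
  exists C => //; apply/setP => i; rewrite finset.in_setI.
  apply/idP/idP => [/andP[/imsetP[j jB ->] fjC]|iD].
    by move/setP/(_ j): eBC; rewrite !inE jB fjC /= => <-.
  have /imsetP[j jB ij] := fintype.subsetP DB _ iD.
  rewrite ij imset_f //=.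
  by move/setP/(_ j): eBC; rewrite !inE jB -ij iD.
apply: card_in_imset => j k jB kB fjk; apply/eqP; apply: contraT => jk.
have [|_ /imsetP[C CF ->] eBC] := h [set j]; first by rewrite finset.sub1set.
move/setP: eBC => eBC; move: (eBC j) (eBC k).
by rewrite !inE jB kB eqxx fjk /= eq_sym (negbTE jk) => ->.
Qed.

(** * Symmetric differences and the Hamming distance between sets *)

Definition symdiff (T : finType) (A B : {set T}) : {set T} :=
  [set x | (x \in A) (+) (x \in B)].

(** Translation by [D] permutes the subsets of [A]: to realize [B], the translated trace
    [A :&: symdiff B D] is asked for instead. *)
Lemma shatters_symdiff (T : finType) (F : {set {set T}}) (D A : {set T}) :
  shatters [set symdiff B D | B in F] A -> shatters F A.
Proof.
move=> /shattersP h; apply/shattersP => B BA.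
have [|_ /imsetP[C CF ->] eAC] := h (A :&: symdiff B D); first exact: finset.subsetIl.
exists C => //; apply/setP => x; move/setP/(_ x): eAC; rewrite !inE.
have := fintype.subsetP BA x.
by case: (x \in A) (x \in B) (x \in C) (x \in D) => [] [] [] [] //= ->.
Qed.

Lemma card_symdiffC (T : finType) (A B : {set T}) : #|symdiff A B| = #|symdiff B A|.
Proof. by congr #|pred_of_set _|; apply/setP => x; rewrite !inE addbC. Qed.

Lemma card_symdiff_triangle (T : finType) (B A C : {set T}) :
  (#|symdiff A C| <= #|symdiff A B| + #|symdiff B C|)%N.
Proof.
apply: leq_trans (leq_card_setU _ _); apply: subset_leq_card.
apply/fintype.subsetP => x; rewrite !inE.
by case: (x \in A) (x \in B) (x \in C) => [] [] [].
Qed.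

Lemma card_le_symdiff (T : finType) (A B : {set T}) :
  (#|A| <= #|B| + #|symdiff B A|)%N.
Proof.
apply: leq_trans (leq_card_setU _ _); apply: subset_leq_card.
by apply/fintype.subsetP => x; rewrite !inE => ->; case: (x \in B).
Qed.

(** Expanding [(1 + x) ^ #|T|] over subsets and keeping the shattered ones, each of weight at least
    [x ^ V], turns the shattering count into an exponential Sauer-Shelah bound. *)
Lemma card_vc_bound (R : realType) (T : finType) (F : {set {set T}}) (V : nat)
    (x : R) : 0 < x -> x <= 1 -> (forall A, shatters F A -> (#|A| <= V)%N) ->
  #|F|%:R * x ^+ V <= expR (x * #|T|%:R).
Proof.
move=> x0 x1 hV.
have -> : x * #|T|%:R = \sum_(t : T) x by rewrite sumr_const mulr_natr.
rewrite expR_sum.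
apply: (@le_trans _ _ (\prod_(t : T) (1 + x))); last first.
  by apply: ler_prod => t _; rewrite expR_ge1Dx addr_ge0 // ltW.
have -> : \prod_(t : T) (1 + x) = \sum_(A : {set T}) x ^+ #|A|.
  under eq_bigr do rewrite addrC.
  by rewrite bigA_distr; apply: eq_bigr => A _; rewrite -big_mkcond prodr_const.
apply: (@le_trans _ _ (\sum_(A : {set T} | shatters F A) x ^+ #|A|)); last first.
  by rewrite [leRHS](bigID (shatters F)) /= lerDl sumr_ge0// => A _; rewrite exprn_ge0 ?ltW.
apply: (@le_trans _ _ (\sum_(A : {set T} | shatters F A) x ^+ V)); last first.
  by apply: ler_sum => A /hV AV; rewrite ler_wiXn2l// ltW.
rewrite (eq_bigl (fun A => A \in [set A | shatters F A])); last by move=> A; rewrite inE.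
rewrite sumr_const -[leRHS]mulr_natl ler_wpM2r ?(exprn_ge0 _ (ltW x0))// ler_nat.
exact: card_shatters.
Qed.

(** The two preimages coincide exactly when [f] never hits the symmetric difference. *)
Lemma card_eq_preimset (I : finType) (m : nat) (A B : {set I}) :
  #|[set f : {ffun 'I_m -> I} | f @^-1: A == f @^-1: B]|
    = (#|~: symdiff A B| ^ m)%N.
Proof.
rewrite -[m in RHS]card_ord -card_ffun_on; apply: eq_card => f; rewrite inE.
apply/eqP/ffun_onP => [e j|h]; last first.
  by apply/setP => j; move: (h j); rewrite !inE; case: (_ \in A) (_ \in B) => [] [].
by move/setP/(_ j): e; rewrite !inE => ->; rewrite addbb.
Qed.

(* A uniformly random [f] identifies two given sets of [F] with probability at
   most [expR (- (e * m))]. *)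
Lemma exists_injective_preimset (R : realType) (I : finType)
    (F : {set {set I}}) (e : R) (m : nat) :
  e <= 1 -> (#|F|%:R ^+ 2 : R) < expR (e * m%:R) -> (0 < #|I|)%N ->
  (forall A B, A \in F -> B \in F -> A != B ->
     e * #|I|%:R <= #|symdiff A B|%:R) ->
  exists f : {ffun 'I_m -> I},
    {in F &, injective (fun A : {set I} => f @^-1: A)}.
Proof.
move=> e1 hm I0 sep.
pose bad (p : {set I} * {set I}) :=
  [set f : {ffun 'I_m -> I} | f @^-1: p.1 == f @^-1: p.2].
pose PF := [set p | [&& p.1 \in F, p.2 \in F & p.1 != p.2]].
suff [f hf] : exists f, [forall p in PF, f \notin bad p].
  exists f => A B AF BF /eqP fAB; apply/eqP; apply: contraT => AB.
  move/forallP: hf => /(_ (A, B)); rewrite !inE /= AF BF AB /=.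
  by rewrite fAB.
apply/existsP; apply: contraT; rewrite negb_exists => /forallP hb.
have badle p : p \in PF ->
    (#|bad p|%:R : R) <= #|I|%:R ^+ m * expR (- (e * m%:R)).
  rewrite inE => /and3P[p1 p2 p12]; rewrite /bad card_eq_preimset.
  have := sep _ _ p1 p2 p12; rewrite natrX -mulNr expRM_natr -exprMn => h.
  apply: lerXn2r; rewrite ?nnegrE ?mulr_ge0 ?expR_ge0//.
  apply: (@le_trans _ _ (#|I|%:R * (1 - e))); last first.
    by rewrite ler_wpM2l// -[leLHS]/(1 + - e) expR_ge1Dx.
  have := cardsC (symdiff p.1 p.2) => /(congr1 (fun k => k%:R : R)).
  by rewrite natrD; lra.
(* Union bound by counting: if every map were bad for some pair, the [bad] sets of at most
   [#|F| ^ 2] pairs would cover all [#|I| ^ m] maps. *)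
have : (#|I|%:R ^+ m : R) <= #|F|%:R ^+ 2 * (#|I|%:R ^+ m * expR (- (e * m%:R))).
  apply: (@le_trans _ _ (\sum_(p in PF) (#|bad p|)%:R)).
    rewrite -natrX -natr_sum ler_nat -[m in leqLHS]card_ord -card_ffun.
    rewrite -sum1_card; under [leqRHS]eq_bigr do rewrite -sum1_card.
    under [leqRHS]eq_bigr do rewrite big_mkcond.
    rewrite [leqRHS]exchange_big /=; apply: leq_sum => f _.
    have := hb f; rewrite negb_forall => /existsP[p].
    rewrite negb_imply negbK => /andP[pPF fp].
    by rewrite (bigD1 p) //= fp.
  apply: (@le_trans _ _ (\sum_(p in PF) (#|I|%:R ^+ m * expR (- (e * m%:R))))).
    exact: ler_sum.
  rewrite sumr_const -[leLHS]mulr_natl ler_wpM2r ?mulr_ge0 ?expR_ge0 ?exprn_ge0//.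
  rewrite -natrX ler_nat -mulnn -cardsX; apply: subset_leq_card.
  by apply/fintype.subsetP => p; rewrite !inE => /and3P[-> ->].
rewrite mulrCA ler_pMr ?exprn_gt0 ?ltr0n//.
by rewrite expRN ler_pdivlMr ?expR_gt0// mul1r leNgt hm.
Qed.

(** On about [2 ln #|F| / e] random points the sets of [F] keep distinct traces, and [card_vc_bound]
    there with [x = e / 4] gives [ln #|F| <= V ln (4 / e) + (ln #|F|) / 2 + e / 4]. Half of
    [ln #|F|] is absorbed, and the bound does not involve [#|I|]. *)
Lemma packing_bound (R : realType) (I : finType) (F : {set {set I}}) (V : nat)
    (e : R) :
  0 < e -> e <= 1 -> (forall A, shatters F A -> (#|A| <= V)%N) ->
  (forall A B, A \in F -> B \in F -> A != B ->
     e * #|I|%:R < #|symdiff A B|%:R) ->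
  ln (#|F|%:R : R) <= 2 * V%:R * ln (4 / e) + 2^-1.
Proof.
move=> e0 e1 hV sep.
have ln0 : 0 <= ln (4 / e).
  by apply: ln_ge0; rewrite ler_pdivlMr// mul1r; lra.
have rhs0 : 0 <= 2 * V%:R * ln (4 / e) + 2^-1 by rewrite addr_ge0// mulr_ge0// mulr_ge0.
have [F1|F2] := leqP #|F| 1.
  apply: le_trans rhs0; apply: ln_le0.
  by rewrite (ler_nat R _ 1).
have I0 : (0 < #|I|)%N.
  move/card_gt1P: F2 => [A [B [AF BF AB]]].
  have := sep _ _ AF BF AB; have := max_card (mem (symdiff A B)).
  case: posnP => // ->; rewrite leqn0 => /eqP ->.
  by rewrite mulr0 ltxx.
set M : R := #|F|%:R; have M1 : 1 <= M by rewrite ler1n ltnW.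
have M0 : 0 < M by apply: lt_le_trans M1.
have lM0 : 0 <= ln M by rewrite ln_ge0.
(* The successor makes [2 * ln M < e * m] strict; the overshoot, at most [e], is paid by the
   additive [2^-1]. *)
pose m := (Num.truncn (2 * ln M / e)).+1.
have mgt : 2 * ln M < e * m%:R.
  by rewrite (mulrC e) -ltr_pdivrMr// /m truncnS_gt.
have mle : e * m%:R <= 2 * ln M + e.
  have : (Num.truncn (2 * ln M / e))%:R <= 2 * ln M / e.
    by rewrite truncn_le divr_ge0// ?mulr_ge0// ltW.
  by rewrite ler_pdivlMr// /m -natr1; lra.
have [|//||f finj] := @exists_injective_preimset R I F e m e1.
- rewrite -ltr_ln ?posrE ?expR_gt0 ?exprn_gt0// expRK.
  by rewrite lnXn// mulr2n; lra.
- by move=> A B AF BF AB; rewrite ltW// sep.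
pose G := [set f @^-1: (A : {set I}) | A : {set I} in F].
have GF : #|G| = #|F| by rewrite card_in_imset.
have GV B : shatters G B -> (#|B| <= V)%N.
  by move=> /shatters_preim[/hV + fB]; rewrite fB.
have x0 : 0 < e / 4 by rewrite divr_gt0.
have x1 : e / 4 <= 1 by lra.
have := card_vc_bound x0 x1 GV; rewrite GF card_ord -/M.
rewrite -ler_ln ?posrE ?expR_gt0 ?mulr_gt0 ?exprn_gt0// expRK.
rewrite lnM ?posrE ?exprn_gt0// lnXn//.
have -> : ln (e / 4) = - ln (4 / e) by rewrite -lnV ?posrE ?divr_gt0// invf_div.
rewrite mulNrn -mulr_natl; lra.
Qed.

(** * Offset Rademacher sums *)

(** A crude subgaussian bound on cosh. For [y <= 1/2] it follows from [expR y <= 1 / (1 - y)] and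
    its mirror image; beyond, [y <= 2 y ^ 2] suffices. *)
Lemma expRD_expRN_le (R : realType) (y : R) :
  expR y + expR (- y) <= 2 * expR (2 * y ^+ 2).
Proof.
wlog y0 : y / 0 <= y => [h|].
  have [/h//|y0] := leP 0 y.
  by have := h (- y); rewrite opprK sqrrN addrC; apply; rewrite oppr_ge0 ltW.
have [y1|y1] := leP y (2^-1).
  have eN : expR (- y) <= (1 + y)^-1.
    by rewrite expRN lef_pV2 ?posrE ?expR_gt0 ?expR_ge1Dx//; lra.
  have eP : expR y <= (1 - y)^-1.
    rewrite -[y in leLHS]opprK expRN lef_pV2 ?posrE ?expR_gt0 ?expR_ge1Dx//; lra.
  apply: le_trans (lerD eP eN) _.
  have e2 : 1 + 2 * y ^+ 2 <= expR (2 * y ^+ 2) by exact: expR_ge1Dx.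
  apply: (@le_trans _ _ (2 * (1 + 2 * y ^+ 2))); last by lra.
  have -> : (1 - y)^-1 + (1 + y)^-1 = 2 / (1 - y ^+ 2).
    by field; apply/and3P; split; nra.
  have y2 : y ^+ 2 <= 4^-1 by nra.
  have := sqr_ge0 y; move: (y ^+ 2) y2 => z z4 z0.
  by rewrite ler_pdivrMr; nra.
rewrite mulr_natl mulr2n lerD// ler_expR; nra.
Qed.

Lemma sum_signs_expR (R : realType) (I : finType) (u : I -> R) :
  \sum_(s : {ffun I -> bool}) expR (\sum_i (-1) ^+ s i * u i) =
  \prod_i (expR (u i) + expR (- u i)).
Proof.
under [RHS]eq_bigr => i _.
  rewrite (_ : _ + _ = \sum_(b : bool) expR ((-1) ^+ b * u i)); last first.
    by rewrite big_bool /= expr1 expr0 mulN1r mul1r addrC.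
  over.
by rewrite bigA_distr_bigA; apply: eq_bigr => s _; rewrite expR_sum.
Qed.

(* An index chosen as a function of the signs replaces a supremum over [Q]. *)
Lemma rademacher_finite_class (R : realType) (I J : finType) (a : I -> R)
    (b : R) (Q : {set J}) (u : J -> I -> R) (tau : {ffun I -> bool} -> J) :
  0 < b -> (forall i, `|a i| <= 5) ->
  (forall j i, u j i ^+ 2 = `|u j i|) -> (forall s, tau s \in Q) ->
  \sum_(s : {ffun I -> bool}) (\sum_i (-1) ^+ s i * (a i * u (tau s) i)
          - b * \sum_i `|u (tau s) i|)
    <= 2 ^+ #|I| * (50 / b * ln #|Q|%:R).
Proof.
(* With [a ^ 2 <= 25], this [l] is the largest for which the variance term [2 l ^ 2 a ^ 2] is
   absorbed by the offset [l b]. *)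
move=> b0 ha hu tauQ; pose l := b / 50.
have l0 : 0 < l by rewrite divr_gt0.
pose X (s : {ffun I -> bool}) j := \sum_i (-1) ^+ s i * (a i * u j i) - b * \sum_i `|u j i|.
have Q0 : (0 < #|Q|)%N by apply/card_gt0P; exists (tau [ffun=> false]).
have mgf j : \sum_s expR (l * X s j) <= 2 ^+ #|I|.
  have -> : \sum_s expR (l * X s j) =
      \prod_i (expR (l * (a i * u j i)) + expR (- (l * (a i * u j i))))
      * expR (- (l * (b * \sum_i `|u j i|))).
    rewrite -sum_signs_expR mulr_suml; apply: eq_bigr => s _.
    rewrite -expRD /X mulrBr; congr expR; congr (_ - _).
    by rewrite mulr_sumr; apply: eq_bigr => i _; rewrite mulrCA.
  rewrite !mulr_sumr -sumrN expR_sum -big_split /= -prodr_const.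
  apply: ler_prod => i _; rewrite mulr_ge0 ?addr_ge0 ?expR_ge0//=.
  rewrite -ler_pdivlMr ?expR_gt0// -expRN opprK.
  apply: le_trans (expRD_expRN_le _) _; rewrite ler_pM2l// ler_expR.
  rewrite !exprMn hu.
  have : a i ^+ 2 <= 25.
    by rewrite -real_normK ?num_real// (_ : 25 = 5 ^+ 2) ?lerXn2r ?nnegrE//; lra.
  move: (a i ^+ 2) (`|u j i|) (normr_ge0 (u j i)) => z w w0 z9.
  have : 0 <= b ^+ 2 * w * (25 - z) by rewrite mulr_ge0 ?subr_ge0// mulr_ge0// sqr_ge0.
  by rewrite /l; lra.
have lnQ : expR (ln #|Q|%:R) = #|Q|%:R :> R by rewrite lnK// posrE ltr0n.
(* The tangent inequality [1 + y <= expR y] at [y = l X - ln #|Q|] replaces Jensen; the selected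
   index is then dominated by the sum over [Q]. *)
have key s : l * X s (tau s) <=
    (\sum_(j in Q) expR (l * X s j)) / #|Q|%:R - 1 + ln #|Q|%:R.
  apply: (@le_trans _ _ (expR (l * X s (tau s)) / #|Q|%:R - 1 + ln #|Q|%:R)).
    have := expR_ge1Dx (l * X s (tau s) - ln #|Q|%:R).
    by rewrite expRD expRN lnQ; lra.
  rewrite !lerD2r ler_wpM2r ?invr_ge0//.
  by rewrite (bigD1 (tau s))//= lerDl sumr_ge0// => j _; rewrite expR_ge0.
have cardS : #|{ffun I -> bool}|%:R = 2 ^+ #|I| :> R.
  by rewrite card_ffun card_bool natrX.
rewrite -(ler_pM2l l0) mulr_sumr.
apply: le_trans; first by apply: ler_sum => s _; exact: key.
have constS (z : R) : \sum_(s : {ffun I -> bool}) z = 2 ^+ #|I| * z.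
  by rewrite sumr_const -[LHS]mulr_natl cardS.
rewrite big_split /= big_split /= !constS -mulr_suml exchange_big /=.
have -> : l * (2 ^+ #|I| * (50 / b * ln #|Q|%:R)) = 2 ^+ #|I| * ln #|Q|%:R.
  by rewrite /l; field; rewrite gt_eqF.
rewrite gerDr mulrN1 subr_le0 ler_pdivrMr ?ltr0n// mulr_natr -sumr_const.
exact: ler_sum.
Qed.

Lemma sum_indicator (R : realType) (I : finType) (A : {set I}) (f : I -> R) :
  \sum_i f i * (i \in A)%:R = \sum_(i in A) f i.
Proof.
by rewrite [RHS]big_mkcond; apply: eq_bigr => i _; case: (i \in A); rewrite ?mulr1 ?mulr0.
Qed.

Lemma rademacher_sets (R : realType) (I : finType) (a : I -> R) (b : R)
    (F : {set {set I}}) (tau : {ffun I -> bool} -> {set I}) :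
  0 < b -> (forall i, `|a i| <= 5) -> (forall s, tau s \in F) ->
  \sum_(s : {ffun I -> bool}) (\sum_(i in tau s) (-1) ^+ s i * a i - b * #|tau s|%:R)
    <= 2 ^+ #|I| * (50 / b * ln #|F|%:R).
Proof.
move=> b0 ha tauF.
pose u (A : {set I}) i : R := (i \in A)%:R.
have hu A i : u A i ^+ 2 = `|u A i|.
  by rewrite /u; case: (i \in A); rewrite ?expr0n ?expr1n ?normr0 ?normr1.
apply: le_trans (rademacher_finite_class b0 ha hu tauF).
apply: ler_sum => s _; apply: lerB.
  rewrite -sum_indicator; apply: ler_sum => i _; by rewrite mulrA.
rewrite ler_pM2l// -sum1_card natr_sum [leRHS]big_mkcond /=.
by apply: ler_sum => i _; rewrite /u; case: (i \in tau s); rewrite ?normr0 ?normr1.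
Qed.

(** Differences of two indicators take values in -1, 0, 1, so the finite-class bound applies with
    pairs from [F] and [G] as indices. *)
Lemma rademacher_set_increments (R : realType) (I : finType) (a : I -> R) (b : R)
    (F G : {set {set I}}) (tau rho : {ffun I -> bool} -> {set I}) :
  0 < b -> (forall i, `|a i| <= 5) ->
  (forall s, tau s \in F) -> (forall s, rho s \in G) ->
  \sum_(s : {ffun I -> bool}) (\sum_(i in tau s) (-1) ^+ s i * a i
      - \sum_(i in rho s) (-1) ^+ s i * a i
      - b * #|symdiff (tau s) (rho s)|%:R)
    <= 2 ^+ #|I| * (50 / b * (ln #|F|%:R + ln #|G|%:R)).
Proof.
move=> b0 ha tauF rhoG.
pose u (A : {set I} * {set I}) i : R := (i \in A.1)%:R - (i \in A.2)%:R.
have hu A i : u A i ^+ 2 = `|u A i|.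
  by rewrite /u; case: (i \in A.1); case: (i \in A.2);
     rewrite ?subrr ?subr0 ?sub0r ?sqrrN ?normrN ?expr0n ?expr1n ?normr0 ?normr1.
have pos (H : {set {set I}}) (f : {ffun I -> bool} -> {set I}) :
    (forall s, f s \in H) -> 0 < (#|H|%:R : R).
  by move=> h; rewrite ltr0n; apply/card_gt0P; exists (f [ffun=> false]).
have tr s : (tau s, rho s) \in finset.setX F G by rewrite finset.in_setX tauF rhoG.
rewrite -lnM ?posrE ?(pos _ _ tauF) ?(pos _ _ rhoG)// -natrM -cardsX.
apply: le_trans (rademacher_finite_class b0 ha hu tr).
apply: ler_sum => s _; apply: lerB.
  rewrite -!sum_indicator -sumrB; apply: ler_sum => i _ /=.
  by rewrite -mulrBr mulrA.
rewrite ler_pM2l// -sum1_card natr_sum [leRHS]big_mkcond /=.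
apply: ler_sum => i _; rewrite inE /u /=; case: (i \in tau s); case: (i \in rho s);
by rewrite ?subrr ?subr0 ?sub0r ?normrN ?normr0 ?normr1.
Qed.

(** A maximal [D]-separated subfamily is a [D]-net: a set far from all its members could be
    added. *)
Lemma exists_net (R : realType) (I : finType) (F : {set {set I}}) (D : R) :
  0 <= D ->
  exists G : {set {set I}}, [/\ G \subset F,
    forall A B, A \in G -> B \in G -> A != B -> D < #|symdiff A B|%:R &
    forall A, A \in F -> exists2 B, B \in G & #|symdiff A B|%:R <= D].
Proof.
move=> D0.
pose sep (G : {set {set I}}) := (G \subset F) && [forall A in G, forall B in G,
  (A != B) ==> (D < #|symdiff A B|%:R)].
have [|G /maxsetP[/andP[GF /forall_inP hs] Gmax]] := @ex_maxset _ sep.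
  exists finset.set0; rewrite /sep finset.sub0set; apply/forall_inP => A.
  by rewrite inE.
have sepG A B : A \in G -> B \in G -> A != B -> D < #|symdiff A B|%:R.
  by move=> /hs/forall_inP h /h/implyP.
exists G; split => // A AF.
have [AG|AG] := boolP (A \in G).
  exists A => //; rewrite (_ : symdiff A A = finset.set0) ?cards0//.
  by apply/setP => x; rewrite !inE addbb.
have [/exists_inP[B BG AB]|/exists_inPn far] :=
  boolP [exists B in G, #|symdiff A B|%:R <= D]; first by exists B.
suff /Gmax : sep (A |: G) by move=> /(_ (finset.subsetUr _ _)) e; rewrite -e setU11 in AG.
rewrite /sep finset.subUset finset.sub1set AF GF /=.
apply/forall_inP => B /setU1P BAG; apply/forall_inP => C /setU1P CAG; apply/implyP.
case: BAG CAG => [->|BG] [->|CG]; rewrite ?eqxx// => BC.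
- by rewrite ltNge far.
- by rewrite card_symdiffC ltNge far.
- exact: sepG.
Qed.

Lemma sum_arith_geom_half_le (R : realType) (x y : R) (K : nat) :
  0 <= x -> 0 <= y -> \sum_(k < K) (x + y * k%:R) / 2 ^+ k <= 2 * x + 2 * y.
Proof.
move=> x0 y0.
suff -> : \sum_(k < K) (x + y * k%:R) / 2 ^+ k =
    2 * x + 2 * y - (2 * x + 2 * y + 2 * y * K%:R) / 2 ^+ K.
  by rewrite gerBl divr_ge0 ?exprn_ge0// !addr_ge0// ?mulr_ge0.
elim: K => [|K IH]; first by rewrite big_ord0 mulr0 addr0 expr0 divr1 subrr.
rewrite big_ord_recr /= IH exprS -natr1.
have : 2 ^+ K != 0 :> R by rewrite expf_neq0.
by move: (2 ^+ K) => z z0; field.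
Qed.

(* Chaining along nets at the scales [V / b ^ 2 / 4 ^ k], with offset [b 2 ^ k]
   at level [k]. *)
Lemma rademacher_vc (R : realType) (I : finType) (a : I -> R) (b : R) (V : nat)
    (F : {set {set I}}) (tau : {ffun I -> bool} -> {set I}) :
  0 < b -> (forall i, `|a i| <= 5) -> (forall s, tau s \in F) ->
  (0 < V)%N -> V%:R <= #|I|%:R * b ^+ 2 ->
  (forall A, shatters F A -> (#|A| <= V)%N) ->
  \sum_(s : {ffun I -> bool}) (\sum_(i in tau s) (-1) ^+ s i * a i - b * #|tau s|%:R)
    <= 2 ^+ #|I| * (3600 * (V%:R / b * (1 + ln (#|I|%:R * b ^+ 2 / V%:R)))).
Proof.
move=> b0 ha tauF V0 VN hV.
set N := #|I| in VN *; set L := 1 + ln _.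
have V0R : 0 < (V%:R : R) by rewrite ltr0n.
have b20 : 0 < b ^+ 2 by rewrite exprn_gt0.
have N0 : 0 < (N%:R : R) by rewrite -(pmulr_lgt0 _ b20); apply: lt_le_trans VN.
have Nb0 : 0 < N%:R * b ^+ 2 / V%:R by rewrite divr_gt0// mulr_gt0.
have l0 : 0 <= ln (N%:R * b ^+ 2 / V%:R).
  by rewrite ln_ge0// ler_pdivlMr// mul1r.
have L1 : 1 <= L by rewrite lerDl.
pose D k : R := V%:R / b ^+ 2 / 4 ^+ k.
have D0 k : 0 <= D k by rewrite !divr_ge0 ?exprn_ge0// ltW.
have [G /all_and3[GF Gsep Gnet]] := choice (fun k => exists_net F (D0 k)).
have ex_pi k A : exists B, A \in F -> B \in G k /\ #|symdiff A B|%:R <= D k.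
  have [AF|] := boolP (A \in F); last by exists A.
  by have [B] := Gnet k A AF; exists B.
have ex_p k : exists q : {set I} -> {set I}, forall A, A \in F ->
    q A \in G k /\ #|symdiff A (q A)|%:R <= D k.
  by have [q hq] := choice (ex_pi k); exists q.
have [p hp] := choice ex_p.
(* The offset doubles while the scale is divided by 4, so the cost [B k * D k] of introducing it is
   geometric in [k]. *)
pose B k : R := b * 2 ^+ k.
have B0 k : 0 < B k by rewrite mulr_gt0// exprn_gt0.
have p20 k : 0 < (2 ^+ k : R) by rewrite exprn_gt0.
have BD k : B k * D k = V%:R / b / 2 ^+ k.
  rewrite /B /D (_ : 4 ^+ k = 2 ^+ k * 2 ^+ k); last first.
    by rewrite -exprMn; congr (_ ^+ _); lra.
  by field; rewrite !gt_eqF.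
have DS k : D k.+1 = D k / 4.
  by rewrite /D (exprSr _ k) -[RHS]mulrA; congr (_ * _); exact: invfM.
have lnG k : ln (#|G k|%:R : R) <= V%:R * (7 * L + 6 * k%:R).
  (* The scale [D k] relative to the number of points, as [packing_bound] requires. *)
  pose e : R := (N%:R * b ^+ 2 / V%:R)^-1 / 4 ^+ k.
  have e0 : 0 < e by rewrite divr_gt0 ?invr_gt0// exprn_gt0.
  have e1 : e <= 1.
    rewrite ler_pdivrMr ?exprn_gt0// mul1r.
    apply: (@le_trans _ _ 1); last by rewrite exprn_ege1// ler1n.
    by rewrite invf_le1// ler_pdivlMr// mul1r.
  have eN : e * #|I|%:R = D k.
    rewrite /e /D -/N mulrAC; congr (_ / _).
    by field; rewrite !gt_eqF.
  have hVG A : shatters (G k) A -> (#|A| <= V)%N.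
    by move=> /(shattersS (GF k)); exact: hV.
  have sepG A A' : A \in G k -> A' \in G k -> A != A' ->
    e * #|I|%:R < #|symdiff A A'|%:R by rewrite eN; exact: Gsep.
  apply: le_trans (packing_bound e0 e1 hVG sepG) _.
  have -> : ln (4 / e) = ln 4 + ln (N%:R * b ^+ 2 / V%:R) + k%:R * ln 4.
    have -> : ln (4 / e) = ln 4 - ln e by rewrite ln_div ?posrE.
    have -> : ln e = - ln (N%:R * b ^+ 2 / V%:R) - ln (4 ^+ k).
      rewrite /e; move: (N%:R * b ^+ 2 / V%:R) Nb0 => x x0.
      by rewrite ln_div ?posrE ?invr_gt0 ?exprn_gt0// lnV ?posrE.
    by rewrite lnXn// -[ln 4 *+ k]mulr_natl; ring.
  have ln4 : ln (4 : R) <= 3 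
    by rewrite (_ : 4 = 1 + 3); [apply: le_ln1Dx|]; lra.
  have k0 : 0 <= (k%:R : R) by [].
  have V1 : 1 <= (V%:R : R) by rewrite ler1n.
  have -> : ln (N%:R * b ^+ 2 / V%:R) = L - 1 by rewrite /L addrC addKr.
  have := ler_wpM2r k0 ln4; nra.
pose S (s : {ffun I -> bool}) (A : {set I}) := \sum_(i in A) (-1) ^+ s i * a i.
have symp k A : A \in F -> #|symdiff A (p k A)|%:R <= D k by move=> /(hp k)[].
have pG k A : A \in F -> p k A \in G k by move=> /(hp k)[].
(* Chaining stops after [N] levels: [D N <= N / 4 ^ N < 1], and a Hamming distance below 1 is 0. *)
have pN A : A \in F -> p N A = A.
  move=> AF; have DN : D N < 1.
    rewrite /D ltr_pdivrMr ?exprn_gt0// mul1r.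
    apply: (@le_lt_trans _ _ N%:R); first by rewrite ler_pdivrMr.
    by rewrite -natrX ltr_nat ltn_expl.
  have := le_lt_trans (symp N A AF) DN; rewrite (ltr_nat R _ 1) ltnS leqn0 cards_eq0 => /eqP/setP e.
  by apply/setP => x; move: (e x); rewrite !inE; case: (_ \in _) (_ \in _) => [] [].
(* Telescoping along the projections. Moving the offset from [A] to [p 0 A] costs [b * D 0 = V / b];
   each link receives an offset worth at most [B k * (D k + D k.+1)], that is
   [5/4 * (V / b) / 2 ^ k]. *)
have ptw s A : A \in F -> S s A - b * #|A|%:R <=
    (S s (p 0 A) - b * #|p 0 A|%:R) + V%:R / b +
    \sum_(k < N) (S s (p k.+1 A) - S s (p k A)
      - B k * #|symdiff (p k.+1 A) (p k A)|%:R + 5 / 4 * (V%:R / b) / 2 ^+ k).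
  move=> AF.
  have bD0 : b * D 0 = V%:R / b by have := BD 0; rewrite /B expr0 mulr1 divr1.
  have h0 : b * #|p 0 A|%:R <= b * #|A|%:R + V%:R / b.
    rewrite -bD0 -mulrDr ler_pM2l//; apply: le_trans (lerD (lexx _) (symp 0 A AF)).
    by rewrite -natrD ler_nat card_le_symdiff.
  have h1 : S s A - S s (p 0 A) = \sum_(k < N) (S s (p k.+1 A) - S s (p k A)).
    rewrite -(big_mkord xpredT (fun k => S s (p k.+1 A) - S s (p k A))).
    by rewrite (telescope_sumr (fun k => S s (p k A)))// pN.
  have h2 : \sum_(k < N) (S s (p k.+1 A) - S s (p k A)) <=
    \sum_(k < N) (S s (p k.+1 A) - S s (p k A)
      - B k * #|symdiff (p k.+1 A) (p k A)|%:R + 5 / 4 * (V%:R / b) / 2 ^+ k).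
    apply: ler_sum => k _; rewrite -addrA lerDl addrC subr_ge0.
    rewrite -mulrA -BD.
    apply: (@le_trans _ _ (B k * (D k + D k.+1))); last by rewrite DS; lra.
    rewrite ler_pM2l//.
    apply: le_trans (lerD (symp k A AF) (symp k.+1 A AF)).
    rewrite -natrD ler_nat addnC [X in (_ <= X + _)%N]card_symdiffC.
    exact: card_symdiff_triangle.
  by move: h0 h1 h2; set x := \sum_(k < N) _; set y := \sum_(k < N) _; lra.
apply: le_trans; first by apply: ler_sum => s _; exact: ptw.
have cardS : #|{ffun I -> bool}|%:R = 2 ^+ N :> R.
  by rewrite card_ffun card_bool natrX.
have constS (z : R) : \sum_(s : {ffun I -> bool}) z = 2 ^+ N * z.
  by rewrite sumr_const -[LHS]mulr_natl cardS.
rewrite big_split /= big_split /= exchange_big /= constS.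
have part0 := rademacher_sets b0 ha (fun s => pG 0 _ (tauF s)).
have partk k := rademacher_set_increments (B0 k) ha
  (fun s => pG k.+1 _ (tauF s)) (fun s => pG k _ (tauF s)).
have Vb0 : 0 < V%:R / b by rewrite divr_gt0.
(* The two net entropies contribute [50 * (14 L + 12 k + 6)]; since [L >= 1], the remaining
   [300 + 5/4] fits in [306 L]. *)
have level k : \sum_(s : {ffun I -> bool}) (S s (p k.+1 (tau s)) - S s (p k (tau s))
      - B k * #|symdiff (p k.+1 (tau s)) (p k (tau s))|%:R
      + 5 / 4 * (V%:R / b) / 2 ^+ k)
    <= 2 ^+ N * (V%:R / b) * ((1006 * L + 600 * k%:R) / 2 ^+ k).
  rewrite big_split /= constS.
  apply: le_trans (lerD (partk k) (lexx _)) _.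
  rewrite -/N -(mulrA (2 ^+ N)) -mulrDr ler_pM2l ?p20//.
  have w0 : 0 <= 50 / B k by rewrite divr_ge0// ltW.
  have := ler_wpM2l w0 (lerD (lnG k.+1) (lnG k)); rewrite -[k.+1%:R]natr1 => h.
  apply: le_trans (lerD h (lexx _)) _.
  have -> : 50 / B k * (V%:R * (7 * L + 6 * (k%:R + 1)) + V%:R * (7 * L + 6 * k%:R))
      = V%:R / b / 2 ^+ k * (50 * (14 * L + 12 * k%:R + 6)).
    by rewrite /B; field; rewrite !gt_eqF.
  have : 0 < V%:R / b / 2 ^+ k by rewrite divr_gt0.
  rewrite -[5 / 4 * (V%:R / b) / 2 ^+ k]mulrA.
  rewrite [X in _ <= X](_ : _ = V%:R / b / 2 ^+ k * (1006 * L + 600 * k%:R)); last by ring.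
  move: (V%:R / b / 2 ^+ k) => z z0.
  have : z <= z * L by rewrite ler_peMr// ltW.
  lra.
have L0 : 0 <= L by apply: le_trans L1.
have geo := @sum_arith_geom_half_le R (1006 * L) 600 N (mulr_ge0 (ler0n _ 1006) L0) (ler0n _ 600).
apply: le_trans.
  apply: lerD; [apply: lerD; [exact: part0|exact: lexx]|].
  by apply: ler_sum => k _; exact: level.
have lnG0 : 50 / b * ln #|G 0|%:R <= V%:R / b * (350 * L).
  have := lnG 0; rewrite mulr0 addr0.
  rewrite -(ler_pM2l (_ : 0 < 50 / b)) ?divr_gt0// => /le_trans; apply.
  by rewrite le_eqVlt; apply/orP; left; apply/eqP; field; rewrite gt_eqF.
(* In units of [V / b], the total is at most [350 L + 1 + 2012 L + 1200], hence at most [3600 L]. *)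
rewrite -mulr_sumr -/N -(mulrA (2 ^+ N)) -!mulrDr ler_pM2l ?p20//.
have := ler_wpM2l (ltW Vb0) geo; set y := \sum_(k < N) _.
have := ler_wpM2l (ltW Vb0) L1; rewrite mulr1; move: lnG0.
by set x := 50 / b * _; move: (V%:R / b) Vb0 => v; clear; lra.
Qed.

(** * Integration of bounded measurable functions *)

Local Open Scope classical_set_scope.
Local Open Scope ring_scope.

(** A class of integrands closed under the operations used below and integrable for every
    probability, so that integrability is never a separate obligation. *)
Definition bounded_measurable d (T : measurableType d) (R : realType)
    (f : T -> R) : Prop :=
  measurable_fun setT f /\ exists M, forall x, `|f x| <= M.

Section bounded_measurable.
Context d (T : measurableType d) (R : realType).
Implicit Types f g : T -> R.

Lemma bounded_measurable_cst (r : R) : bounded_measurable (fun _ : T => r).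
Proof. by split; [exact: measurable_cst|exists `|r|]. Qed.

Lemma bounded_measurableD f g : bounded_measurable f -> bounded_measurable g ->
  bounded_measurable (fun x => f x + g x).
Proof.
move=> [mf [M hM]] [mg [N hN]]; split; first exact: measurable_funD.
by exists (M + N) => x; apply: le_trans (ler_normD _ _) (lerD _ _).
Qed.

Lemma bounded_measurableM f g : bounded_measurable f -> bounded_measurable g ->
  bounded_measurable (fun x => f x * g x).
Proof.
move=> [mf [M hM]] [mg [N hN]]; split; first exact: measurable_funM.
by exists (M * N) => x; rewrite normrM ler_pM.
Qed.

Lemma bounded_measurableZ (r : R) f : bounded_measurable f ->
  bounded_measurable (fun x => r * f x).
Proof. by apply: bounded_measurableM; exact: bounded_measurable_cst. Qed.

Lemma bounded_measurableB f g : bounded_measurable f -> bounded_measurable g ->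
  bounded_measurable (fun x => f x - g x).
Proof.
move=> bf bg; rewrite (_ : (fun _ => _) = (fun x => f x + (-1) * g x)).
  by apply: bounded_measurableD => //; exact: bounded_measurableZ.
by apply/funext => x; rewrite mulN1r.
Qed.

Lemma bounded_measurable_sum (I : Type) (r : seq I) (F : I -> T -> R) :
  (forall i, bounded_measurable (F i)) ->
  bounded_measurable (fun x => \sum_(i <- r) F i x).
Proof.
move=> bF; elim: r => [|i r IH].
  by under eq_fun do rewrite big_nil; exact: bounded_measurable_cst.
by under eq_fun do rewrite big_cons; exact: bounded_measurableD.
Qed.

Lemma bounded_measurable_comp d' (T' : measurableType d') (h : T' -> T) f :
  measurable_fun setT h -> bounded_measurable f ->
  bounded_measurable (fun x => f (h x)).
Proof.
move=> mh [mf [M hM]]; split; last by exists M => x; exact: hM.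
exact: measurableT_comp.
Qed.

Lemma bounded_measurable_bool (b : T -> bool) : measurable_fun setT b ->
  bounded_measurable (fun x => (b x)%:R : R).
Proof.
move=> mb; split.
  by apply: (measurableT_comp (f := fun c : bool => c%:R : R)) => // _ Y _.
by exists 1 => x; case: (b x); rewrite ?normr1 ?normr0.
Qed.

Lemma bounded_measurable_neq (b c : T -> bool) : measurable_fun setT b ->
  measurable_fun setT c -> bounded_measurable (fun x => (b x != c x)%:R : R).
Proof.
move=> mb mc.
rewrite (_ : (fun _ => _) = (fun x =>
    ((b x)%:R + (c x)%:R) - 2 * ((b x)%:R * (c x)%:R))).
  apply: bounded_measurableB.
    by apply: bounded_measurableD; exact: bounded_measurable_bool.
  by apply: bounded_measurableZ; apply: bounded_measurableM; exact: bounded_measurable_bool.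
by apply/funext => x; case: (b x); case: (c x); rewrite /=; lra.
Qed.

Variable mu : {measure set T -> \bar R}.
Hypothesis mu1 : mu setT = 1%E.

Lemma bounded_measurable_integrable f : bounded_measurable f ->
  mu.-integrable setT (EFin \o f).
Proof.
move=> [mf [M hM]]; apply: measurable_bounded_integrable => //.
  by rewrite mu1 ltry.
exists M; split; first exact: num_real.
by move=> x Mx y _ /=; apply: le_trans (hM y) (ltW _).
Qed.

Lemma bm_EFin_Rintegral f : bounded_measurable f ->
  (\int[mu]_x (f x)%:E)%E = (\int[mu]_x f x)%:E.
Proof.
move=> /bounded_measurable_integrable fi.
by rewrite /Rintegral fineK//; exact: integrable_fin_num.
Qed.

Lemma bm_RintegralD f g : bounded_measurable f -> bounded_measurable g ->
  \int[mu]_x (f x + g x) = \int[mu]_x f x + \int[mu]_x g x.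
Proof. by move=> bf bg; rewrite RintegralD//; exact: bounded_measurable_integrable. Qed.

Lemma bm_RintegralB f g : bounded_measurable f -> bounded_measurable g ->
  \int[mu]_x (f x - g x) = \int[mu]_x f x - \int[mu]_x g x.
Proof. by move=> bf bg; rewrite RintegralB//; exact: bounded_measurable_integrable. Qed.

Lemma bm_RintegralZl (r : R) f : bounded_measurable f ->
  \int[mu]_x (r * f x) = r * \int[mu]_x f x.
Proof. by move=> bf; rewrite RintegralZl//; exact: bounded_measurable_integrable. Qed.

Lemma bm_Rintegral_cst (r : R) : \int[mu]_x r = r.
Proof. by rewrite Rintegral_cst// mu1 /= mulr1. Qed.

Lemma bm_Rintegral_sum (I : Type) (r : seq I) (F : I -> T -> R) :
  (forall i, bounded_measurable (F i)) ->
  \int[mu]_x (\sum_(i <- r) F i x) = \sum_(i <- r) \int[mu]_x F i x.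
Proof.
move=> bF; elim: r => [|i r IH].
  by rewrite big_nil; under eq_Rintegral do rewrite big_nil; exact: bm_Rintegral_cst.
rewrite big_cons; under eq_Rintegral do rewrite big_cons.
by rewrite bm_RintegralD ?IH//; exact: bounded_measurable_sum.
Qed.

Lemma bm_le_Rintegral f g : bounded_measurable f -> bounded_measurable g ->
  (forall x, f x <= g x) -> \int[mu]_x f x <= \int[mu]_x g x.
Proof.
by move=> bf bg fg; apply: le_Rintegral => //; exact: bounded_measurable_integrable.
Qed.

End bounded_measurable.

(** The first conclusion lets the inner integral serve as an integrand in turn. *)
Lemma bm_Rintegral_fubini d d' (T : measurableType d) (T' : measurableType d')
    (R : realType) (P : probability T R) (Q : probability T' R) (f : T * T' -> R) :
  bounded_measurable f ->
  bounded_measurable (fun x => \int[Q]_y f (x, y)) /\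
  \int[P]_x \int[Q]_y f (x, y) = \int[(P \x Q)%E]_z f z.
Proof.
move=> bf; have PQ1 : (P \x Q)%E setT = 1%E.
  rewrite -setXTT; transitivity (P setT * Q setT)%E; first exact: product_measure1E.
  by rewrite !probability_setT mule1.
have fi := bounded_measurable_integrable PQ1 bf.
have bfx x : bounded_measurable (fun y => f (x, y)).
  by apply: (bounded_measurable_comp (h := fun y => (x, y)) _ bf); exact: pair1_measurable.
have FE : fubini_F Q (EFin \o f) = EFin \o (fun x => \int[Q]_y f (x, y)).
  by apply/funext => x; rewrite /fubini_F /= (bm_EFin_Rintegral (probability_setT Q) (bfx x)).
split.
  split; first by apply/measurable_EFinP; rewrite -FE; exact: (measurable_fubini_F fi).
  have [_ [M hM]] := bf; exists M => x.
  have bM : bounded_measurable (fun _ : T' => M) by exact: bounded_measurable_cst.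
  have := bm_le_Rintegral (probability_setT Q) (bfx x) bM (fun y => le_trans (ler_norm _) (hM _)).
  have b0 : bounded_measurable (fun _ : T' => - M) by exact: bounded_measurable_cst.
  have hN y : - M <= f (x, y) by have := hM (x, y); rewrite ler_norml => /andP[].
  have := bm_le_Rintegral (probability_setT Q) b0 (bfx x) hN.
  rewrite !(bm_Rintegral_cst (probability_setT Q)) => h1 h2.
  by rewrite ler_norml h2 h1.
by rewrite /Rintegral -(integral12_prod_meas1 fi) FE.
Qed.

(** * Symmetrization *)

(** The [n]-fold product law, specified on boxes only: they form a generating class stable under
    intersection. *)
Definition iid_law d (T : measurableType d) (R : realType) (n : nat)
    (P : probability T R) (Q : probability (n.-tuple T) R) : Prop :=
  forall B : 'I_n -> set T, (forall i, measurable (B i)) ->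
    Q [set z | forall i, B i (tnth z i)] = (\prod_(i < n) P (B i))%E.

(** The second component plays the ghost sample; summing over [s] creates the Rademacher signs. *)
Definition swap_tuple T n (s : {ffun 'I_n -> bool}) (p : n.-tuple T * n.-tuple T) :
    n.-tuple T * n.-tuple T :=
  ([tuple if s i then tnth p.2 i else tnth p.1 i | i < n],
   [tuple if s i then tnth p.1 i else tnth p.2 i | i < n]).

Section swap.
Context d (T : measurableType d) (R : realType) (n : nat).
Local Notation tup := (n.-tuple T).

Lemma measurable_tnth1 i : measurable_fun setT (fun p : tup * tup => tnth p.1 i).
Proof. by apply: (measurableT_comp (measurable_tnth i)). Qed.

Lemma measurable_tnth2 i : measurable_fun setT (fun p : tup * tup => tnth p.2 i).
Proof. by apply: (measurableT_comp (measurable_tnth i)). Qed.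

Lemma measurable_swap_tuple (s : {ffun 'I_n -> bool}) :
  measurable_fun setT (@swap_tuple T n s).
Proof.
apply: measurable_fun_pair; apply/measurable_fun_tnthP => i.
  rewrite (_ : _ \o _ = fun p : tup * tup => if s i then tnth p.2 i else tnth p.1 i).
    by case: (s i); [exact: measurable_tnth2|exact: measurable_tnth1].
  by apply/funext => p /=; rewrite tnth_mktuple.
rewrite (_ : _ \o _ = fun p : tup * tup => if s i then tnth p.1 i else tnth p.2 i).
  by case: (s i); [exact: measurable_tnth1|exact: measurable_tnth2].
by apply/funext => p /=; rewrite tnth_mktuple.
Qed.

Definition rectangle (B : ('I_n -> set T) * ('I_n -> set T)) : set (tup * tup) :=
  [set p | forall i, B.1 i (tnth p.1 i)] `&` [set p | forall i, B.2 i (tnth p.2 i)].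

Definition measurable_sides : set (('I_n -> set T) * ('I_n -> set T)) :=
  [set B | forall i, measurable (B.1 i) /\ measurable (B.2 i)].

Lemma measurable_tuple_box (B : 'I_n -> set T) : (forall i, measurable (B i)) ->
  measurable [set z : tup | forall i, B i (tnth z i)].
Proof.
move=> mB; rewrite (_ : [set _ | _] = \bigcap_(i in [set: 'I_n]) (@tnth n T ^~ i @^-1` B i)).
  apply: fin_bigcap_measurable => // i _.
  by rewrite -[X in measurable X]setTI; exact: measurable_tnth.
by apply/seteqP; split => [z h i _|z h i]; exact: h.
Qed.

Lemma rectangleE B : rectangle B =
  [set z : tup | forall i, B.1 i (tnth z i)] `*` [set z : tup | forall i, B.2 i (tnth z i)].
Proof. by []. Qed.

Lemma measurable_rectangle B : measurable_sides B -> measurable (rectangle B).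
Proof.
move=> mB; rewrite rectangleE; apply: measurableX;
by apply: measurable_tuple_box => i; case: (mB i).
Qed.

Lemma rectangles_generate (E : set (tup * tup)) :
  measurable E -> <<s rectangle @` measurable_sides >> E.
Proof.
pose G : set (set (tup * tup)) := rectangle @` measurable_sides.
suff h : measurable_fun setT (fun p : g_sigma_algebraType G => p : tup * tup).
  by move=> mE; have := h measurableT E mE; rewrite setTI.
apply/measurable_fun_pairP; split; apply/measurable_fun_tnthP => i _ Y mY;
  rewrite setTI; apply: sub_sigma_algebra.
- exists ((fun j => if j == i then Y else setT), fun=> setT).
    by move=> j /=; case: (j == i).
  apply/seteqP; split => [p [/(_ i)]/=|p /= h]; first by rewrite eqxx.
  by split => // j /=; case: eqP => [->|].
- exists (fun=> setT, (fun j => if j == i then Y else setT)).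
    by move=> j /=; case: (j == i).
  apply/seteqP; split => [p [_ /(_ i)]/=|p /= h]; first by rewrite eqxx.
  by split => // j /=; case: eqP => [->|].
Qed.

(** Uniqueness of finite measures on a generating class stable under intersection and containing the
    whole space. *)
Lemma rectangle_measure_unique (m1 m2 : {measure set (tup * tup) -> \bar R}) :
  (m1 setT < +oo)%E ->
  (forall B, measurable_sides B -> m1 (rectangle B) = m2 (rectangle B)) ->
  forall E, measurable E -> m1 E = m2 E.
Proof.
move=> m1oo m12 E mE.
have GT : (rectangle @` measurable_sides) setT.
  by exists (fun=> setT, fun=> setT) => [i|]; [split; exact: measurableT|apply/seteqP; split].
apply: (@g_sigma_algebra_measure_unique _ R _ (rectangle @` measurable_sides)
  _ (fun=> setT)) => //.
- by move=> _ [B mB <-]; exact: measurable_rectangle.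
- by apply/seteqP; split => // p _; exists 0%N.
- move=> _ _ [B mB <-] [C mC <-].
  exists ((fun i => B.1 i `&` C.1 i), (fun i => B.2 i `&` C.2 i)).
    by move=> i /=; have [? ?] := mB i; have [? ?] := mC i; split; exact: measurableI.
  apply/seteqP; split => [p [h1 h2]|p [[h1 h2] [h3 h4]]].
    by split; split => i; have /= [] := h1 i; have /= [] := h2 i.
  by split => i; split.
- by move=> _ [B mB <-]; exact: m12.
- exact: rectangles_generate.
Qed.

Variables (P : probability T R) (Q : probability tup R).
Hypothesis iidQ : iid_law P Q.

Lemma product_rectangle B : measurable_sides B ->
  (Q \x Q)%E (rectangle B) = (\prod_(i < n) (P (B.1 i) * P (B.2 i)))%E.
Proof.
move=> mB; rewrite rectangleE.
transitivity (Q [set z | forall i, B.1 i (tnth z i)] *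
              Q [set z | forall i, B.2 i (tnth z i)])%E.
  by apply: product_measure1E; apply: measurable_tuple_box => i; case: (mB i).
by rewrite !iidQ ?big_split// => i; case: (mB i).
Qed.

(** A swap pulls a rectangle back to the one with sides exchanged where [s i] holds, and the factors
    of its product measure commute. *)
Lemma swap_tuple_invariant (s : {ffun 'I_n -> bool}) (f : tup * tup -> R) :
  bounded_measurable f ->
  \int[(Q \x Q)%E]_p f (swap_tuple s p) = \int[(Q \x Q)%E]_p f p.
Proof.
move=> bf.
have QQ1 : (Q \x Q)%E setT = 1%E.
  rewrite -setXTT; transitivity (Q setT * Q setT)%E; first exact: product_measure1E.
  by rewrite !probability_setT mule1.
have QQoo : ((Q \x Q)%E setT < +oo)%E by rewrite QQ1 ltry.
pose swapmf : {mfun _ >-> _} := HB.pack (@swap_tuple T n s)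
  (isMeasurableFun.Build _ _ _ _ _ (measurable_swap_tuple s)).
rewrite /Rintegral; congr fine.
have bfs := bounded_measurable_comp (measurable_swap_tuple s) bf.
rewrite [RHS](eq_measure_integral (pushforward (Q \x Q)%E swapmf)); last first.
  move=> E mE _; apply: rectangle_measure_unique E mE => [|B mB].
    exact: QQoo.
  pose B' := ((fun i => if s i then B.2 i else B.1 i),
              (fun i => if s i then B.1 i else B.2 i)).
  have mB' : measurable_sides B' by move=> i /=; have [] := mB i; case: (s i).
  transitivity ((Q \x Q)%E (rectangle B')).
    transitivity (\prod_(i < n) (P (B.1 i) * P (B.2 i)))%E; first exact: product_rectangle.
    rewrite product_rectangle//; apply: eq_bigr => i _ /=.
    by case: (s i) => //; rewrite muleC.
  congr ((Q \x Q)%E _); apply/seteqP; split => p [h1 h2]; split => i;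
  by move: (h1 i) (h2 i); rewrite /= !tnth_mktuple; case: (s i).
have mf : measurable_fun setT (EFin \o f) by apply/measurable_EFinP; case: bf.
by rewrite (integral_pushforward (measurable_swap_tuple s) mf
  (bounded_measurable_integrable QQ1 bfs) measurableT).
Qed.

(** All [2 ^ n] swapped copies of [F] have the same integral, so a bound on their sum for each fixed
    pair of samples is enough. *)
Lemma symmetrization (F : tup * tup -> R) (K : tup -> R) :
  bounded_measurable F -> bounded_measurable K ->
  (forall z z', \sum_(s : {ffun 'I_n -> bool}) F (swap_tuple s (z, z'))
     <= 2 ^+ n * (K z + K z')) ->
  \int[Q]_z \int[Q]_z' F (z, z') <= 2 * \int[Q]_z K z.
Proof.
move=> bF bK FK.
have QQ1 : (Q \x Q)%E setT = 1%E.
  rewrite -setXTT; transitivity (Q setT * Q setT)%E; first exact: product_measure1E.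
  by rewrite !probability_setT mule1.
have [_ ->] := bm_Rintegral_fubini Q Q bF.
have cardS : #|{ffun 'I_n -> bool}|%:R = 2 ^+ n :> R.
  by rewrite card_ffun card_bool natrX card_ord.
rewrite -(ler_pM2l (_ : 0 < 2 ^+ n)) ?exprn_gt0//.
have -> : 2 ^+ n * \int[(Q \x Q)%E]_z F z =
    \int[(Q \x Q)%E]_p (\sum_(s : {ffun 'I_n -> bool}) F (swap_tuple s p)).
  rewrite bm_Rintegral_sum//; last first.
    by move=> s; exact: bounded_measurable_comp (measurable_swap_tuple s) bF.
  under eq_bigr do rewrite swap_tuple_invariant//.
  by rewrite sumr_const -[RHS]mulr_natl cardS.
have b1 : bounded_measurable (fun p : tup * tup => K p.1).
  exact: bounded_measurable_comp measurable_fst bK.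
have b2 : bounded_measurable (fun p : tup * tup => K p.2).
  exact: bounded_measurable_comp measurable_snd bK.
have bG : bounded_measurable (fun p : tup * tup => 2 ^+ n * (K p.1 + K p.2)).
  by apply: bounded_measurableZ; exact: bounded_measurableD.
apply: le_trans.
  apply: (bm_le_Rintegral QQ1 _ bG); last by move=> [z z']; exact: FK.
  apply: bounded_measurable_sum => s.
  exact: bounded_measurable_comp (measurable_swap_tuple s) bF.
rewrite bm_RintegralZl ?bm_RintegralD//; last exact: bounded_measurableD.
rewrite ler_pM2l ?exprn_gt0//.
have [_ <-] := bm_Rintegral_fubini Q Q b1.
have [_ <-] := bm_Rintegral_fubini Q Q b2 => /=.
under eq_Rintegral do rewrite (bm_Rintegral_cst (probability_setT Q)).
by rewrite (bm_Rintegral_cst (probability_setT Q)) mulr_natl mulr2n.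
Qed.

End swap.

(** * Traces of a class on a sample *)

(** Traces are recorded as sets of indices rather than of points, which keeps them in one finite
    type for all samples, repeated points included. *)
Definition traces (X : Type) (n : nat) (A : set (set X)) (x : 'I_n -> X) :
    {set {set 'I_n}} :=
  [set I : {set 'I_n} |
    `[< exists2 B, A B & forall i, (i \in I) = (x i \in B) >]]%SET.

Lemma tracesP (X : Type) (n : nat) (A : set (set X)) (x : 'I_n -> X)
    (I : {set 'I_n}) :
  (exists2 B, A B & forall i, (i \in I) = (x i \in B)) <-> I \in traces A x.
Proof. by rewrite inE; split => [/asboolP|/asboolP]. Qed.

Lemma card_range_ord (T : Type) (n : nat) (f : 'I_n -> T) :
  injective f -> (range f #= `I_n)%card.
Proof.
move=> finj; apply: card_eq_trans (card_esym card_II).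
by apply: inj_card_eq => i j _ _; exact: finj.
Qed.

Lemma range_ord_card (T : Type) (n : nat) (C : set T) :
  (C #= `I_n)%card -> exists f : 'I_n -> T, range f = C.
Proof.
move=> Cn.
have /card_eqP[g] : ([set: 'I_n] #= C)%card.
  by apply: card_eq_trans (card_esym card_II) (card_esym Cn).
exists (fun i => set_val (g (to_setT i))); apply/seteqP; split => [_ [i _ <-]|c Cc].
  exact: set_valP.
have [[i iT] _ gi] := 'surj_g (I : [set: C] (SigSub (mem_set Cc))).
exists i => //; rewrite (_ : to_setT i = exist _ i iT) ?gi//.
exact/val_inj.
Qed.

(** A trace treats indices of equal points alike, so it can be recovered from its image under
    [x]. *)
Lemma card_traces (X : Type) (n : nat) (A : set (set X)) (x : 'I_n -> X) :
  #|traces A x| = trace_card A (range x).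
Proof.
pose img (I : {set 'I_n}) : set X := x @` [set i | i \in I].
have imgE (I : {set 'I_n}) B : (forall i, (i \in I) = (x i \in B)) ->
    img I = B `&` range x.
  move=> IB; apply/seteqP; split => [_ [i iI <-]|c [Bc [i _ xic]]].
    by split; [move: iI; rewrite /= IB inE|exists i].
  by exists i => //=; rewrite IB xic inE.
pose f (k : 'I_#|traces A x|) := img (enum_val k).
have fP (k : 'I_#|traces A x|) : exists2 B, A B &
    forall i, (i \in (enum_val k : {set 'I_n})) = (x i \in B).
  by apply/tracesP; exact: enum_valP.
rewrite /trace_card (_ : [set B `&` range x | B in A] = range f).
  apply/esym/card_fset_set/card_range_ord => k l fkl.
  apply: enum_val_inj; apply/setP => i.
  have [B _ kB] := fP k; have [B' _ lB] := fP l.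
  rewrite kB lB; move: fkl; rewrite /f (imgE _ _ kB) (imgE _ _ lB) => /seteqP[s1 s2].
  apply/idP/idP; rewrite !inE => xB.
    by have [] : (B' `&` range x) (x i) by apply: s1; split => //; exists i.
  by have [] : (B `&` range x) (x i) by apply: s2; split => //; exists i.
apply/seteqP; split => [_ [B AB <-]|_ [k _ <-]]; last first.
  by have [B AB kB] := fP k; exists B => //; rewrite /f (imgE _ _ kB).
have IB : [set i | x i \in B]%SET \in traces A x.
  by apply/tracesP; exists B => // i; rewrite inE.
exists (enum_rank_in IB [set i | x i \in B]%SET) => //.
by rewrite /f enum_rankK_in// (imgE _ B)// => i; rewrite inE.
Qed.

Lemma card_traces_le (X : Type) (n : nat) (A : set (set X)) (x : 'I_n -> X) :
  (#|traces A x| <= 2 ^ n)%N.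
Proof.
by apply: leq_trans (max_card _) _; rewrite -cardsT -powersetT card_powerset cardsT card_ord.
Qed.

(** The points indexed by a shattered [J] are distinct and have all [2 ^ #|J|] traces, so the growth
    function is maximal at [#|J|], which [V] bounds. *)
Lemma shatters_traces (X : Type) (n : nat) (A : set (set X)) (V : nat)
    (x : 'I_n -> X) (J : {set 'I_n}) :
  vc_dimension A V -> shatters (traces A x) J -> (#|J| <= V)%N.
Proof.
move=> [ubV _] /shattersP shJ; apply: ubV => /=.
set k := #|J|; pose y (j : 'I_k) := x (enum_val j).
have full (K : {set 'I_k}) : K \in traces A y.
  have [|I /tracesP[B AB IB] JI] := shJ (enum_val @: K)%SET.
    by apply/fintype.subsetP => _ /imsetP[j _ ->]; exact: enum_valP.
  apply/tracesP; exists B => // j; rewrite -IB.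
  rewrite -[RHS]andTb -(enum_valP j) -finset.in_setI JI mem_imset//.
  exact: enum_val_inj.
(* The trace of a singleton separates its index from every other one. *)
have yinj : injective y.
  move=> j j' yj; have /tracesP[B _ KB] := full [set j]%SET.
  by move: (KB j) (KB j'); rewrite yj => <-; rewrite !inE eqxx => /eqP.
have cardy : #|traces A y| = (2 ^ k)%N.
  apply/eqP; rewrite eqn_leq card_traces_le /=.
  rewrite (_ : traces A y = [set: {set 'I_k}]%SET); last by apply/setP => K; rewrite full inE.
  by rewrite -powersetT card_powerset cardsT card_ord.
have rangey : (range y #= `I_k)%card.
  exact: card_range_ord.
rewrite /growth_function.
set T := [set trace_card A C | C in _].
have Tmax : T (2 ^ k)%N by exists (range y) => //; rewrite -card_traces.
have Tub : ubound T (2 ^ k)%N.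
  by move=> _ [C /range_ord_card[z <-] <-]; rewrite -card_traces; exact: card_traces_le.
have supT : supremums T (2 ^ k)%N by split => // z; exact.
(* [T] is nonempty, so [supremum] does not return its default value; uniqueness of suprema then
   identifies it. *)
rewrite /supremum ifF; last by apply/negP => /eqP T0; rewrite T0 in Tmax.
by case: xgetP => [z _ zT|/(_ _ supT)//]; exact: is_subset1_supremums zT supT.
Qed.

Lemma card_traces_gt0 (X : Type) (n : nat) (A : set (set X)) (x : 'I_n -> X) :
  A !=set0 -> (0 < #|traces A x|)%N.
Proof.
move=> [B AB]; apply/card_gt0P; exists [set i | x i \in B]%SET.
by apply/tracesP; exists B => // i; rewrite inE.
Qed.

Lemma measurable_indicators d (X : measurableType d) (A : set (set X)) t :
  (forall B, A B -> measurable B) -> indicators A t -> measurable_fun setT t.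
Proof.
move=> mA [B AB <-]; apply: (measurable_fun_bool true).
rewrite setTI (_ : _ @^-1` _ = B); first exact: mA.
by apply/seteqP; split => x; [exact: set_mem|exact: mem_set].
Qed.

(** A convergent sequence of values in 0, 1 is eventually constant, and finitely many sample points
    allow a common index. *)
Lemma separable_class_agree (R : realType) (X : Type) (S' : set (X -> bool))
    (t : X -> bool) (n : nat) (x : 'I_n -> X) :
  (exists2 u : nat -> X -> bool, (forall k, S' (u k)) &
      forall (x : X) (y : bool),
        (fun k => (y != u k x)%:R : R) @ \oo --> ((y != t x)%:R : R)) ->
  exists2 u, S' u & forall i, u (x i) = t (x i).
Proof.
move=> [u S'u ut].
have [k hk] : exists k, forall i, u k (x i) = t (x i).
  suff : \forall k \near \oo, forall i, u k (x i) = t (x i).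
    by case=> N _ h; exists N; exact: h (leqnn N).
  apply: filter_forall => i.
  have /cvgrPdist_lt/(_ 1 ltr01) := ut (x i) true.
  apply: filterS => k.
  by case: (u k (x i)); case: (t (x i)); rewrite /= ?subr0 ?sub0r ?normrN ?normr1 ?ltxx.
by exists (u k).
Qed.

Section sample.
Context d (X : measurableType d) (R : realType) (n : nat).
Variable A : set (set X).
Local Notation tup := (n.-tuple (X * bool)%type).

Definition points (z : tup) (i : 'I_n) : X := (tnth z i).1.

(** By condition (M) the classifiers of the countable [S'] realize every trace, so the event is a
    countable union of boxes. *)
Lemma measurable_traces (I : {set 'I_n}) :
  (forall B, A B -> measurable B) -> separable_class R (indicators A) ->
  measurable [set z : tup | I \in traces A (points z)].
Proof.
move=> mA [S' [S'S cS' dense]].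
pose box (u : X -> bool) := [set z : tup | forall i, (i \in I) = u (points z i)].
rewrite (_ : [set _ | _] = \bigcup_(u : set_type S') box (set_val u)).
  apply: countable_bigcupT_measurable => [|u].
    by rewrite (eq_countable (card_setT S')).
  have mu : measurable_fun setT (set_val u).
    exact: (measurable_indicators mA (S'S _ (set_valP u))).
  pose B (i : 'I_n) : set (X * bool) := [set p | (i \in I) = set_val u p.1].
  apply: (@measurable_tuple_box _ _ _ B) => i.
  have mu1 : measurable_fun setT (fun p : X * bool => set_val u p.1).
    exact: measurableT_comp.
  rewrite -[X in measurable X]setTI.
  rewrite (_ : B i = (fun p : X * bool => set_val u p.1) @^-1` [set i \in I]).
    exact: mu1.
  by apply/seteqP; split => p /esym.
apply/seteqP; split => [z /= /tracesP[B AB IB]|z [u _ /= uz]].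
  have [|u S'u ut] := separable_class_agree (points z) (dense (fun x => x \in B) _).
    by exists B.
  by exists (SigSub (mem_set S'u)) => // i /=; rewrite IB -ut.
have [B AB uB] := S'S _ (set_valP u).
by apply/tracesP; exists B => // i; rewrite uz /= [LHS](congr1 (@^~ _) (esym uB)).
Qed.

Lemma bounded_measurable_ln_card_traces :
  (forall B, A B -> measurable B) -> separable_class R (indicators A) ->
  bounded_measurable (fun z : tup => ln (#|traces A (points z)|%:R : R)).
Proof.
move=> mA sepA; split.
  apply: (measurableT_comp (measurable_ln (R := R))).
  rewrite (_ : (fun _ => _) =
    (fun z : tup => \sum_(I : {set 'I_n}) (I \in traces A (points z))%:R)).
    have := @bounded_measurable_sum _ tup R _ (index_enum {set 'I_n})
      (fun I z => (I \in traces A (points z))%:R : R).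
    case=> [I|//]; apply: bounded_measurable_bool; apply: (measurable_fun_bool true).
    by rewrite setTI; exact: measurable_traces.
  apply/funext => z; rewrite -sum1_card natr_sum big_mkcond.
  by apply: eq_bigr => I _; case: (I \in _).
exists (ln (2 ^ n)%:R) => z.
(* The count vanishes for an empty class; there [ln] takes its default value 0. *)
have := card_traces_le A (points z); case: (#|_|) => [|k] hk.
  by rewrite ln0// normr0 ln_ge0// ler1n expn_gt0.
rewrite ger0_norm ?ln_ge0 ?ler1n// ler_ln ?posrE ?ltr0n ?expn_gt0//.
by rewrite ler_nat.
Qed.

End sample.

(** * Empirical risk minimization *)

Section offset_gap.
Context d (X : measurableType d) (R : realType) (n : nat).
Local Notation tup := (n.-tuple (X * bool)%type).
Variables (s : X -> bool) (c : R).
Implicit Types t : X -> bool.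

Definition excess t (u : X * bool) : R := (u.2 != t u.1)%:R - (u.2 != s u.1)%:R.

Definition disagree t (u : X * bool) : R := (s u.1 != t u.1)%:R.

(** [p.1] is the sample and [p.2] the ghost sample. The offset is charged to the ghost sample alone,
    whose average becomes an L1 distance. *)
Definition offset_gap t (p : tup * tup) : R :=
  \sum_(i < n) (4 * excess t (tnth p.2 i) - 4 * excess t (tnth p.1 i)
                - 2 * c * disagree t (tnth p.2 i)).

(* [4 * excess t - c * disagree t] is [weight] on [t <> s] and vanishes elsewhere. *)
Definition weight (u : X * bool) : R := 4 * (-1) ^+ (u.2 != s u.1) - c.

Definition disagree_set t (z : tup) : {set 'I_n} :=
  [set i | s (points z i) != t (points z i)]%SET.

(** The one-sided offset [2 c] splits into a part antisymmetric in the two samples, which joins the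
    signed sums through [weight], and an offset [c] on each sample. The sums over [z] and [z'] then
    separate. *)
Lemma offset_gap_swap t (e : {ffun 'I_n -> bool}) (z z' : tup) :
  offset_gap t (swap_tuple e (z, z')) =
    (\sum_(i in disagree_set t z') (-1) ^+ e i * weight (tnth z' i)
       - c * #|disagree_set t z'|%:R) +
    (\sum_(i in disagree_set t z) (-1) ^+ e i * - weight (tnth z i)
       - c * #|disagree_set t z|%:R).
Proof.
have cE (D : {set 'I_n}) : c * #|D|%:R = \sum_i c * (i \in D)%:R.
  by rewrite -mulr_sumr -sum1_card natr_sum big_mkcond; congr (_ * _);
     apply: eq_bigr => i _; case: (i \in D).
rewrite !cE -!sum_indicator -!sumrB -big_split /=; apply: eq_bigr => i _.
rewrite !inE /points /excess /disagree /weight /= !tnth_mktuple.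
case: (e i); case: (tnth z i) => x y; case: (tnth z' i) => x' y' /=;
by case: y; case: y'; case: (t x); case: (t x'); case: (s x); case: (s x');
  rewrite /= ?expr0 ?expr1; ring.
Qed.

Variable A : set (set X).

(** The traces translated by that of [s]: this preserves the shattering bound and does not increase
    the cardinality. *)
Definition disagree_family (z : tup) : {set {set 'I_n}} :=
  [set symdiff I [set i | s (points z i)] | I : {set 'I_n} in traces A (points z)]%SET.

Lemma disagree_set_family t (z : tup) : indicators A t ->
  disagree_set t z \in disagree_family z.
Proof.
move=> [B AB tB]; apply/imsetP; exists [set i | points z i \in B]%SET.
  by apply/tracesP; exists B => // i; rewrite inE.
apply/setP => i; rewrite !inE -tB.
by case: (s _); case: (_ \in B).
Qed.

(** The minimizer is computed from the swapped sample and so varies with the signs; this is why the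
    bound on the sums must allow any selection [tau]. *)
Lemma sum_offset_gap_swap_le (shat : tup -> X -> bool) (K : tup -> R) (z z' : tup) :
  0 <= c -> c <= 1 -> (forall w, indicators A (shat w)) ->
  (forall w (a : 'I_n -> R) (tau : {ffun 'I_n -> bool} -> {set 'I_n}),
    (forall i, `|a i| <= 5) -> (forall e, tau e \in disagree_family w) ->
    \sum_(e : {ffun 'I_n -> bool})
      (\sum_(i in tau e) (-1) ^+ e i * a i - c * #|tau e|%:R) <= 2 ^+ n * K w) ->
  \sum_(e : {ffun 'I_n -> bool})
     offset_gap (shat (swap_tuple e (z, z')).1) (swap_tuple e (z, z'))
  <= 2 ^+ n * (K z + K z').
Proof.
move=> c0 c1 shatA hK.
have w5 u : `|weight u| <= 5.
  rewrite /weight ler_norml; case: (_ != _); rewrite ?expr0 ?expr1; lra.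
under eq_bigr do rewrite offset_gap_swap.
rewrite big_split /= addrC mulrDr; apply: lerD.
  apply: (hK z (fun i => - weight (tnth z i))) => [i|e]; first by rewrite normrN.
  exact: disagree_set_family.
apply: (hK z' (fun i => weight (tnth z' i))) => [i|e] //.
exact: disagree_set_family.
Qed.

End offset_gap.

(** * Expected offset gap of the empirical risk minimizer *)

Lemma measurable_neqb d (T : measurableType d) (b c : T -> bool) :
  measurable_fun setT b -> measurable_fun setT c ->
  measurable_fun setT (fun x => b x != c x).
Proof.
move=> mb mc.
rewrite (_ : (fun _ => _) = (fun x => if b x then ~~ c x else c x)).
  by apply: measurable_fun_ifT => //; exact: measurableT_comp.
by apply/funext => x; case: (b x); case: (c x).
Qed.

Section expected_gap.
Context d (X : measurableType d) (R : realType) (n : nat).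
Local Notation Y := (X * bool)%type.
Local Notation tup := (n.-tuple Y).
Variables (P : probability Y R) (Q : probability tup R).
Hypothesis iidQ : iid_law P Q.

Lemma Rintegral_bool d' (T : measurableType d') (mu : {measure set T -> \bar R})
    (b : T -> bool) : measurable_fun setT b ->
  \int[mu]_x (b x)%:R = fine (mu [set x | b x]).
Proof.
move=> mb; have mB : measurable [set x | b x].
  by have := mb measurableT [set true] (ltac:(by [])); rewrite setTI.
transitivity (fine (\int[mu]_x (\1_[set x | b x] x)%:E)%E); last first.
  by rewrite integral_indic// setIT.
congr fine; apply: eq_integral => x _; rewrite indicE; congr ((nat_of_bool _)%:R%:E).
by apply/idP/idP; rewrite inE.
Qed.

Lemma iid_law_coordinate (i : 'I_n) (B : set Y) : measurable B ->
  Q [set z | B (tnth z i)] = P B.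
Proof.
move=> mB; pose C j := if j == i then B else setT.
have mC j : measurable (C j) by rewrite /C; case: ifP.
have := iidQ mC; rewrite /C (bigD1 i)//= eqxx big1 ?mule1; last first.
  by move=> j /negbTE ->; exact: probability_setT.
move=> <-.
congr (Q _); apply/seteqP; split => z /=; last by move=> /(_ i); rewrite eqxx.
by move=> Bz j; case: eqP => [->|].
Qed.

Lemma Rintegral_coordinate (i : 'I_n) (b : Y -> bool) : measurable_fun setT b ->
  \int[Q]_z (b (tnth z i))%:R = \int[P]_u (b u)%:R :> R.
Proof.
move=> mb; have mB : measurable [set u | b u].
  by have := mb measurableT [set true] (ltac:(by [])); rewrite setTI.
rewrite !Rintegral_bool//; last exact: measurableT_comp (measurable_tnth i).
by congr fine; exact: (iid_law_coordinate i mB).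
Qed.

Lemma risk_Rintegral (t : X -> bool) : measurable_fun setT t ->
  risk P t = \int[P]_u (u.2 != t u.1)%:R.
Proof.
move=> mt; rewrite Rintegral_bool//; apply: measurable_neqb => //.
exact: measurableT_comp.
Qed.

Lemma L1_dist_Rintegral (s t : X -> bool) : measurable_fun setT s ->
  measurable_fun setT t -> L1_dist P s t = \int[P]_u (s u.1 != t u.1)%:R.
Proof.
move=> ms mt.
rewrite /L1_dist Lnorm1 /Rintegral; congr fine.
rewrite ge0_integral_distribution//.
  apply: eq_integral => u _ /=; congr EFin.
  by case: (s u.1); case: (t u.1); rewrite ?subrr ?subr0 ?sub0r ?normrN ?normr0 ?normr1.
apply: measurableT_comp => //; apply/measurable_EFinP.
exact: (bounded_measurableB (bounded_measurable_bool R ms) (bounded_measurable_bool R mt)).1.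
Qed.

Variables (A : set (set X)) (s : X -> bool) (shat : tup -> X -> bool).
Hypotheses (mA : forall B, A B -> measurable B) (As : indicators A s).
Hypothesis erm : empirical_risk_minimizer R (indicators A) shat.

Let ms : measurable_fun setT s.
Proof. exact: measurable_indicators As. Qed.

Let shatA z : indicators A (shat z).
Proof. by case: erm. Qed.

Let mshat z : measurable_fun setT (shat z).
Proof. exact: measurable_indicators (shatA z). Qed.

Let mshat2 d' (T : measurableType d') (f : T -> tup) (g : T -> X) :
  measurable_fun setT f -> measurable_fun setT g ->
  measurable_fun setT (fun x => shat (f x) (g x)).
Proof.
move=> mf mg; have [mh _ _] := erm.
exact: (measurableT_comp mh (measurable_fun_pair mf mg)).
Qed.

Lemma bounded_measurable_erm_loss :
  bounded_measurable (fun z => relative_loss P s (shat z)).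
Proof.
apply: bounded_measurableB; last exact: bounded_measurable_cst.
rewrite (_ : (fun z => _) = (fun z => \int[P]_u (u.2 != shat z u.1)%:R)); last first.
  by apply/funext => z; rewrite risk_Rintegral.
have h : bounded_measurable (fun p : tup * Y => (p.2.2 != shat p.1 p.2.1)%:R : R).
  apply: bounded_measurable_neq; first exact: measurableT_comp.
  by apply: mshat2 => //; exact: measurableT_comp.
by have [] := bm_Rintegral_fubini Q P h.
Qed.

Lemma bounded_measurable_erm_dist :
  bounded_measurable (fun z => L1_dist P s (shat z)).
Proof.
rewrite (_ : (fun z => _) = (fun z => \int[P]_u (s u.1 != shat z u.1)%:R)); last first.
  by apply/funext => z; rewrite L1_dist_Rintegral.
have h : bounded_measurable (fun p : tup * Y => (s p.2.1 != shat p.1 p.2.1)%:R : R).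
  apply: bounded_measurable_neq.
    by apply: measurableT_comp => //; exact: measurableT_comp.
  by apply: mshat2 => //; exact: measurableT_comp.
by have [] := bm_Rintegral_fubini Q P h.
Qed.

Lemma bounded_measurable_offset_gap (c : R) :
  bounded_measurable (fun p => offset_gap s c (shat p.1) p).
Proof.
have me1 i : bounded_measurable (fun p : tup * tup => excess R s (shat p.1) (tnth p.1 i)).
  apply: bounded_measurableB; apply: bounded_measurable_neq.
  - by apply: (measurableT_comp measurable_snd); exact: measurable_tnth1.
  - apply: mshat2 => //; apply: (measurableT_comp measurable_fst); exact: measurable_tnth1.
  - by apply: (measurableT_comp measurable_snd); exact: measurable_tnth1.
  - apply: (measurableT_comp ms); apply: (measurableT_comp measurable_fst); exact: measurable_tnth1.
have me2 i : bounded_measurable (fun p : tup * tup => excess R s (shat p.1) (tnth p.2 i)).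
  apply: bounded_measurableB; apply: bounded_measurable_neq.
  - by apply: (measurableT_comp measurable_snd); exact: measurable_tnth2.
  - apply: mshat2 => //; apply: (measurableT_comp measurable_fst); exact: measurable_tnth2.
  - by apply: (measurableT_comp measurable_snd); exact: measurable_tnth2.
  - apply: (measurableT_comp ms); apply: (measurableT_comp measurable_fst); exact: measurable_tnth2.
have md2 i : bounded_measurable (fun p : tup * tup => disagree R s (shat p.1) (tnth p.2 i)).
  apply: bounded_measurable_neq.
  - apply: (measurableT_comp ms); apply: (measurableT_comp measurable_fst); exact: measurable_tnth2.
  - apply: mshat2 => //; apply: (measurableT_comp measurable_fst); exact: measurable_tnth2.
apply: bounded_measurable_sum => i; apply: bounded_measurableB.
  by apply: bounded_measurableB; exact: bounded_measurableZ.
exact: bounded_measurableZ.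
Qed.

Lemma sum_excess_erm_le0 z : \sum_(i < n) excess R s (shat z) (tnth z i) <= 0.
Proof.
have [n0|n0] := posnP n; first by
  rewrite big1// => i; move: (ltn_ord i); rewrite [X in (_ < X)%N]n0.
have [_ _ /(_ z s As)] := erm.
rewrite /empirical_risk ler_pM2l ?invr_gt0 ?ltr0n// => h.
by rewrite /excess sumrB subr_le0.
Qed.

(** Integration over the ghost sample turns its terms into [relative_loss] and [L1_dist]; the term
    left on the sample is dropped because the empirical excess of the minimizer is nonpositive. *)
Lemma le_Rintegral_offset_gap (c : R) z :
  n%:R * (4 * relative_loss P s (shat z) - 2 * c * L1_dist P s (shat z)) <=
  \int[Q]_z' offset_gap s c (shat z) (z, z').
Proof.
have Q1 := probability_setT Q.
have bneq (t u : Y -> bool) i : measurable_fun setT t -> measurable_fun setT u ->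
    bounded_measurable (fun z' : tup => (t (tnth z' i) != u (tnth z' i))%:R : R).
  by move=> mt mu; apply: bounded_measurable_neq; exact: measurableT_comp (measurable_tnth i).
have mt1 (t : X -> bool) : measurable_fun setT t ->
    measurable_fun setT (fun u : Y => t u.1) by move=> mt; exact: measurableT_comp.
have m2 : measurable_fun setT (fun u : Y => u.2) by exact: measurable_snd.
have bl i t (mt : measurable_fun setT t) := bneq _ _ i m2 (mt1 t mt).
have be i : bounded_measurable (fun z' : tup => excess R s (shat z) (tnth z' i)).
  by apply: bounded_measurableB; exact: bl.
have bd i : bounded_measurable (fun z' : tup => disagree R s (shat z) (tnth z' i)).
  exact: (bneq _ _ i (mt1 s ms) (mt1 _ (mshat z))).
have int_excess i : \int[Q]_z' excess R s (shat z) (tnth z' i) =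
    relative_loss P s (shat z).
  rewrite (bm_RintegralB Q1 (bl i _ (mshat z)) (bl i _ ms)).
  rewrite /relative_loss !risk_Rintegral//; congr (_ - _).
    exact: (Rintegral_coordinate i (measurable_neqb m2 (mt1 _ (mshat z)))).
  exact: (Rintegral_coordinate i (measurable_neqb m2 (mt1 _ ms))).
have int_disagree i : \int[Q]_z' disagree R s (shat z) (tnth z' i) =
    L1_dist P s (shat z).
  rewrite L1_dist_Rintegral//.
  exact: (Rintegral_coordinate i (measurable_neqb (mt1 _ ms) (mt1 _ (mshat z)))).
rewrite /offset_gap /= bm_Rintegral_sum//; last first.
  move=> i; apply: bounded_measurableB; last exact: bounded_measurableZ.
  apply: bounded_measurableB; first exact: bounded_measurableZ.
  exact: bounded_measurable_cst.
rewrite (eq_bigr (fun i : 'I_n => 4 * relative_loss P s (shat z)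
    - 4 * excess R s (shat z) (tnth z i) - 2 * c * L1_dist P s (shat z))); last first.
  move=> i _ /=.
  have b4 := bounded_measurableZ 4 (be i).
  have bc := bounded_measurable_cst tup (4 * excess R s (shat z) (tnth z i)).
  have b2 := bounded_measurableZ (2 * c) (bd i).
  rewrite (bm_RintegralB Q1 (bounded_measurableB b4 bc) b2) (bm_RintegralB Q1 b4 bc).
  rewrite (bm_RintegralZl Q1 _ (be i)) (bm_RintegralZl Q1 _ (bd i)).
  by rewrite int_excess int_disagree (bm_Rintegral_cst Q1).
rewrite !sumrB -!mulr_sumr !sumr_const card_ord.
rewrite -[relative_loss _ _ _ *+ n]mulr_natl -[L1_dist _ _ _ *+ n]mulr_natl.
by have := sum_excess_erm_le0 z; lra.
Qed.

End expected_gap.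

(** * Expected loss for a fixed offset *)

Section erm_bounds.
Context d (X : measurableType d) (R : realType) (n : nat).
Local Notation Y := (X * bool)%type.
Local Notation tup := (n.-tuple Y).
Variables (P : probability Y R) (Q : probability tup R).
Hypothesis iidQ : iid_law P Q.
Variables (A : set (set X)) (s : X -> bool) (shat : tup -> X -> bool).
Hypotheses (mA : forall B, A B -> measurable B) (As : indicators A s).
Hypothesis erm : empirical_risk_minimizer R (indicators A) shat.
Hypothesis n0 : (0 < n)%N.
Variables (c k r : R).
Hypotheses (c0 : 0 < c) (c1 : c <= 1).
Hypothesis hk : forall t, indicators A t ->
  k * relative_loss P s t - r <= 2 * relative_loss P s t - c * L1_dist P s t.

(** The parameters serve both regimes: [k = 2], [r = c] without margin, [k = 1] and [r] the fast
    rate with it. Twice [hk] matches the previous gap, whose integral is at most twice that of [K]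
    by symmetrization. *)
Lemma erm_expected_loss (K : tup -> R) : bounded_measurable K ->
  (forall w (a : 'I_n -> R) (tau : {ffun 'I_n -> bool} -> {set 'I_n}),
    (forall i, `|a i| <= 5) -> (forall e, tau e \in disagree_family s A w) ->
    \sum_(e : {ffun 'I_n -> bool})
      (\sum_(i in tau e) (-1) ^+ e i * a i - c * #|tau e|%:R) <= 2 ^+ n * K w) ->
  k * \int[Q]_z relative_loss P s (shat z) <= r + n%:R^-1 * \int[Q]_z K z.
Proof.
move=> bK hK.
have Q1 := probability_setT Q.
have shatA z : indicators A (shat z) by case: erm.
have bl := bounded_measurable_erm_loss P Q s mA erm.
have bd := bounded_measurable_erm_dist P Q mA As erm.
have bF := bounded_measurable_offset_gap mA As erm c.
have [bI _] := bm_Rintegral_fubini Q Q bF.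
have sym := symmetrization iidQ bF bK
  (fun z z' => sum_offset_gap_swap_le z z' (ltW c0) c1 shatA hK).
have bkl : bounded_measurable (fun z => k * relative_loss P s (shat z) - r).
  by apply: bounded_measurableB; [exact: bounded_measurableZ|exact: bounded_measurable_cst].
have b2 := bounded_measurableZ (2 * n%:R) bkl.
have gap z : 2 * n%:R * (k * relative_loss P s (shat z) - r) <=
    \int[Q]_z' offset_gap s c (shat z) (z, z').
  apply: le_trans (le_Rintegral_offset_gap iidQ mA As erm c z).
  have n0R : 0 < 2 * n%:R :> R by rewrite mulr_gt0 ?ltr0n.
  have := ler_wpM2l (ltW n0R) (hk (shatA z)); move=> /le_trans; apply; lra.
have := le_trans (bm_le_Rintegral Q1 b2 bI gap) sym.
rewrite (bm_RintegralZl Q1 _ bkl) (bm_RintegralB Q1 (bounded_measurableZ k bl)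
  (bounded_measurable_cst _ r)) (bm_RintegralZl Q1 _ bl) (bm_Rintegral_cst Q1).
by rewrite -mulrA ler_pM2l// -ler_pdivlMl ?ltr0n// lerBlDl.
Qed.

Lemma erm_entropy_bound : separable_class R (indicators A) ->
  k * \int[Q]_z relative_loss P s (shat z) <=
  r + 50 * (\int[Q]_z ln #|traces A (points z)|%:R / (n%:R * c)).
Proof.
move=> sepA.
have bH := bounded_measurable_ln_card_traces n mA sepA.
have A0 : A !=set0 by have [B AB _] := As; exists B.
have := erm_expected_loss (bounded_measurableZ (50 / c) bH).
rewrite (bm_RintegralZl (probability_setT Q) _ bH).
rewrite (_ : n%:R^-1 * _ = 50 * (\int[Q]_z ln #|traces A (points z)|%:R / (n%:R * c))); last first.
  by field; rewrite (gt_eqF c0) pnatr_eq0 -lt0n n0.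
apply => w a tau a5 tauF.
have := rademacher_sets c0 a5 tauF; rewrite card_ord => /le_trans; apply.
rewrite ler_pM2l ?exprn_gt0// ler_pM2l ?divr_gt0//.
have F0 : (0 < #|disagree_family s A w|)%N.
  by apply/card_gt0P; exists (tau [ffun=> false]).
rewrite ler_ln ?posrE ?ltr0n ?card_traces_gt0// ler_nat.
exact: leq_imset_card.
Qed.

Lemma erm_vc_bound (V : nat) : vc_dimension A V -> (0 < V)%N ->
  V%:R <= n%:R * c ^+ 2 ->
  k * \int[Q]_z relative_loss P s (shat z) <=
  r + 3600 * (V%:R * (1 + ln (n%:R * c ^+ 2 / V%:R)) / (n%:R * c)).
Proof.
move=> vcV V0 Vn.
have := erm_expected_loss (bounded_measurable_cst _
  (3600 * (V%:R / c * (1 + ln (n%:R * c ^+ 2 / V%:R))))).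
rewrite (bm_Rintegral_cst (probability_setT Q)).
rewrite (_ : n%:R^-1 * _ =
    3600 * (V%:R * (1 + ln (n%:R * c ^+ 2 / V%:R)) / (n%:R * c))); last first.
  by field; rewrite (gt_eqF c0) pnatr_eq0 -lt0n n0.
apply => w a tau a5 tauF.
have := rademacher_vc c0 a5 tauF V0 (V := V); rewrite !card_ord; apply => //.
by move=> J /shatters_symdiff; exact: shatters_traces.
Qed.

End erm_bounds.

(** * Rates under the margin condition *)

Section margin.
Variable R : realType.
Implicit Types th h r l x u n V : R.

(** Two cases replace Young's inequality: if [h x <= r ^ (1 / th)] the product is at most [r];
    otherwise [r ^ (1 - 1 / th) <= (h x) ^ (th - 1)] and it is at most [(h x) ^ th <= l]. *)
Lemma margin_linearized th h r l x : 1 <= th -> 0 < h -> 0 < r -> 0 <= x ->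
  h `^ th * x `^ th <= l -> h * r `^ (1 - th^-1) * x <= l + r.
Proof.
move=> th1 h0 r0 x0; have th0 : 0 < th by apply: lt_le_trans th1.
have hx0 : 0 <= h * x by rewrite mulr_ge0// ltW.
rewrite -powRM ?(ltW h0)// => hl; rewrite mulrAC.
have l0 : 0 <= l by apply: le_trans hl; exact: powR_ge0.
have thN0 : th != 0 by rewrite gt_eqF.
have [hr|hr] := leP (h * x) (r `^ th^-1).
  apply: (@le_trans _ _ (r `^ th^-1 * r `^ (1 - th^-1))).
    by rewrite ler_wpM2r ?powR_ge0.
  rewrite -powRD; last by rewrite (gt_eqF r0) implybT.
  by rewrite addrC subrK powRr1 ?(ltW r0)// lerDr.
apply: (@le_trans _ _ ((h * x) `^ th)); last by rewrite (le_trans hl)// lerDl ltW.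
have hx : 0 < h * x by apply: le_lt_trans hr; exact: powR_ge0.
have -> : (h * x) `^ th = h * x * (h * x) `^ (th * (1 - th^-1)).
  rewrite -{2}(powRr1 hx0) -powRD; last by rewrite (gt_eqF hx) implybT.
  by rewrite mulrBr mulr1 mulfV// addrC subrK.
rewrite ler_pM2l// powRrM; apply: ge0_ler_powR; rewrite ?nnegrE ?powR_ge0 ?(ltW r0)//.
  by rewrite subr_ge0 invf_le1.
rewrite -[leLHS](powRr1 (ltW r0)) -(mulVf thN0) powRrM.
by apply: ge0_ler_powR; rewrite ?nnegrE ?powR_ge0 ?(ltW th0)// ltW.
Qed.

Definition fast_rate th h n u := (u / (n * h)) `^ (th / (2 * th - 1)).

Definition offset_level th h n u := h * fast_rate th h n u `^ (1 - th^-1).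

Lemma fast_rate_gt0 th h n u : 0 < h -> 0 < n -> 0 < u -> 0 < fast_rate th h n u.
Proof. by move=> h0 n0 u0; apply: powR_gt0; rewrite divr_gt0// mulr_gt0. Qed.

Lemma offset_level_gt0 th h n u : 0 < h -> 0 < n -> 0 < u -> 0 < offset_level th h n u.
Proof.
move=> h0 n0 u0; apply: mulr_gt0 => //; apply: powR_gt0.
exact: fast_rate_gt0.
Qed.

Lemma ln_fast_rate th h n u : 0 < h -> 0 < n -> 0 < u ->
  ln (fast_rate th h n u) = th / (2 * th - 1) * (ln u - (ln n + ln h)).
Proof.
move=> h0 n0 u0; rewrite /fast_rate ln_powR.
by rewrite ln_div ?posrE ?mulr_gt0// lnM ?posrE.
Qed.

Lemma ln_offset_level th h n u : 0 < h -> 0 < n -> 0 < u ->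
  ln (offset_level th h n u) =
    ln h + (1 - th^-1) * (th / (2 * th - 1) * (ln u - (ln n + ln h))).
Proof.
move=> h0 n0 u0; have r0 := fast_rate_gt0 th h0 n0 u0.
rewrite lnM ?posrE ?(powR_gt0 _ r0)//.
by rewrite ln_powR ln_fast_rate.
Qed.

(** The rate solves [r = u / (n h r ^ (1 - 1 / th))], because [2 - 1 / th] is the inverse of its
    exponent. Logarithms make this a linear identity. *)
Lemma offset_level_rate th h n u : 1 <= th -> 0 < h -> 0 < n -> 0 < u ->
  u / (n * offset_level th h n u) = fast_rate th h n u.
Proof.
move=> th1 h0 n0 u0.
have c0 := offset_level_gt0 th h0 n0 u0; have r0 := fast_rate_gt0 th h0 n0 u0.
have uc0 : 0 < u / (n * offset_level th h n u) by rewrite divr_gt0// mulr_gt0.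
have nc0 : 0 < n * offset_level th h n u by rewrite mulr_gt0.
suff : ln (u / (n * offset_level th h n u)) = ln (fast_rate th h n u).
  by move=> /ln_inj; apply; rewrite posrE.
rewrite ln_div ?posrE// lnM ?posrE// ln_offset_level// ln_fast_rate//.
by field; apply/andP; split; lra.
Qed.

Lemma offset_level_le1 th h n u : 1 <= th -> 0 < h -> h <= 1 -> 0 < n -> 0 < u ->
  fast_rate th h n u <= 1 -> offset_level th h n u <= 1.
Proof.
move=> th1 h0 h1 n0 u0 r1; have r0 := fast_rate_gt0 th h0 n0 u0.
rewrite /offset_level -[leRHS]mulr1; apply: ler_pM; rewrite ?(ltW h0) ?powR_ge0//.
have t1 : 0 <= 1 - th^-1 by rewrite subr_ge0 invf_le1//; lra.
rewrite -[leRHS](_ : 1 `^ (1 - th^-1) = 1); last by rewrite powR1.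
by apply: ge0_ler_powR; rewrite ?nnegrE// ltW.
Qed.

(** The logarithm of [n c ^ 2 / V] is a combination of [l - 1] and [ln l] with coefficients in
    [0, 1], and [0 <= ln l <= l - 1]. It is therefore nonnegative and at most [2 (l - 1)]. *)
Lemma ln_offset_level_vc th h n V : 1 <= th -> 0 < h -> 0 < n -> 0 < V ->
  0 <= ln (n * h `^ (2 * th) / V) ->
  let l := 1 + ln (n * h `^ (2 * th) / V) in
  let c := offset_level th h n (V * l) in
  V <= n * c ^+ 2 /\ 1 + ln (n * c ^+ 2 / V) <= 2 * l.
Proof.
move=> th1 h0 n0 V0 x0 l c.
have l1 : 1 <= l by rewrite lerDl.
have l0 : 0 < l by lra.
have c0 : 0 < c by rewrite offset_level_gt0// mulr_gt0.
have lnl0 : 0 <= ln l by rewrite ln_ge0.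
have lnl : ln l <= l - 1 by have := @le_ln1Dx R (l - 1); rewrite (addrC 1) subrK; apply; lra.
have t0 : 0 < 2 * th - 1 by lra.
have e : ln (n * c ^+ 2 / V) =
    (2 * th - 1)^-1 * (l - 1) + (2 * th - 2) / (2 * th - 1) * ln l.
  have cc0 : 0 < c ^+ 2 by rewrite exprn_gt0.
  have nc0 : 0 < n * c ^+ 2 by rewrite mulr_gt0.
  have hh0 : 0 < h `^ (2 * th) by exact: powR_gt0.
  have nh0 : 0 < n * h `^ (2 * th) by rewrite mulr_gt0.
  have lE : l - 1 = ln n + 2 * th * ln h - ln V.
    rewrite /l addrAC subrr add0r ln_div ?posrE// [ln (n * _)]lnM ?posrE//.
    by rewrite ln_powR.
  rewrite ln_div ?posrE// lnM ?posrE// lnXn// ln_offset_level ?mulr_gt0//.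
  rewrite lE [ln (V * _)]lnM ?posrE// mulr2n.
  by field; apply/andP; split; lra.
have i1 : (2 * th - 1)^-1 <= 1 by rewrite invf_le1//; lra.
have i0 : 0 <= (2 * th - 1)^-1 by rewrite invr_ge0 ltW.
have j1 : (2 * th - 2) / (2 * th - 1) <= 1 by rewrite ler_pdivrMr//; lra.
have j0 : 0 <= (2 * th - 2) / (2 * th - 1) by rewrite divr_ge0//; lra.
have y0 : 0 <= ln (n * c ^+ 2 / V) by rewrite e addr_ge0 ?mulr_ge0//; lra.
split.
  rewrite -[leLHS]mul1r -ler_pdivlMr// leNgt; apply/negP => y1.
  have q0 : 0 < n * c ^+ 2 / V by rewrite divr_gt0// mulr_gt0// exprn_gt0.
  have /ln_lt0 : 0 < n * c ^+ 2 / V < 1 by rewrite q0.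
  by rewrite ltNge y0.
rewrite e; move: ((2 * th - 1)^-1) ((2 * th - 2) / _) i0 i1 j0 j1 => i j i0 i1 j0 j1.
have : i * (l - 1) <= l - 1 by rewrite ler_piMl// subr_ge0.
have : j * ln l <= ln l by rewrite ler_piMl.
lra.
Qed.

End margin.

(** * Law of the sample and transfer of expectations *)

Section sample_law.
Context d0 (Omega : measurableType d0) d (T : measurableType d) (R : realType).
Variables (Pr : probability Omega R) (P : probability T R) (n : nat).
Variable Z : 'I_n -> {RV Pr >-> T}.

Definition sample (w : Omega) : n.-tuple T := [tuple Z i w | i < n].

Lemma measurable_sample : measurable_fun setT sample.
Proof.
apply/measurable_fun_tnthP => i.
rewrite (_ : _ \o _ = Z i); first exact: measurable_funP.
by apply/funext => w /=; rewrite tnth_mktuple.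
Qed.

HB.instance Definition _ := isMeasurableFun.Build _ _ _ _ sample measurable_sample.

Lemma iid_copies_law : iid_copies P Z ->
  iid_law P (distribution Pr (sample : {mfun Omega >-> n.-tuple T})).
Proof.
move=> [lawZ indep] B mB.
rewrite /distribution /pushforward.
transitivity (Pr (\bigcap_(i in [set` [set: 'I_n]%SET]) (Z i @^-1` B i))).
  congr (Pr _); apply/seteqP; split => w h i /=.
    by have := h i; rewrite tnth_mktuple.
  by rewrite tnth_mktuple; apply: (h i); rewrite /= finset.in_setT.
rewrite indep; last by move=> i _; exact: mB.
by apply: eq_big => [i|i _]; [rewrite finset.in_setT|exact: lawZ].
Qed.

Lemma expectation_sample (f : n.-tuple T -> R) : bounded_measurable f ->
  ('E_Pr[fun w => f (sample w)] =
   (\int[distribution Pr (sample : {mfun Omega >-> n.-tuple T})]_z f z)%:E)%E.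
Proof.
move=> bf; rewrite unlock.
rewrite -(bm_EFin_Rintegral (probability_setT _) bf).
rewrite integral_distribution//; first by apply/measurable_EFinP; case: bf.
apply: (bounded_measurable_integrable (probability_setT Pr)).
exact: bounded_measurable_comp measurable_sample bf.
Qed.

End sample_law.

(** * Trivial bounds on the loss and the L1 distance *)

Section loss_bounds.
Context d (X : measurableType d) (R : realType).
Variable P : probability (X * bool)%type R.

Lemma relative_loss_le1 s t : measurable_fun setT s -> measurable_fun setT t ->
  relative_loss P s t <= 1.
Proof.
move=> ms mt; rewrite /relative_loss.
have P1 := probability_setT P.
have b t' (mt' : measurable_fun setT t') : bounded_measurable
    (fun u : X * bool => (u.2 != t' u.1)%:R : R).
  by apply: bounded_measurable_neq; [exact: measurable_snd|exact: measurableT_comp].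
have b1 := @bounded_measurable_cst _ (X * bool)%type R 1.
have r1 : risk P t <= 1.
  rewrite risk_Rintegral// -[leRHS](bm_Rintegral_cst P1).
  by apply: (bm_le_Rintegral P1 (b t mt) b1) => u; case: (_ != _).
have r0 : 0 <= risk P s by exact: fine_ge0.
lra.
Qed.

Lemma L1_dist_ge0 s t : 0 <= L1_dist P s t.
Proof. by apply: fine_ge0; exact: Lnorm_ge0. Qed.

Lemma L1_dist_le1 s t : measurable_fun setT s -> measurable_fun setT t ->
  L1_dist P s t <= 1.
Proof.
move=> ms mt; have P1 := probability_setT P.
have b : bounded_measurable (fun u : X * bool => (s u.1 != t u.1)%:R : R).
  by apply: bounded_measurable_neq; exact: measurableT_comp.
have b1 := @bounded_measurable_cst _ (X * bool)%type R 1.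
rewrite L1_dist_Rintegral// -[leRHS](bm_Rintegral_cst P1).
by apply: (bm_le_Rintegral P1 b b1) => u; case: (_ != _).
Qed.

End loss_bounds.

(** * Choice of the offset and assembly of the slow and fast rates *)

Theorem corollary3 (R : realType) :
  exists C : R,
  forall (d : measure_display) (X : measurableType d)
    (P : probability (X * bool)%type R) (eta : X -> R)
    (d0 : measure_display) (Omega : measurableType d0)
    (Pr : probability Omega R) (n : nat)
    (XY : 'I_n -> {RV Pr >-> (X * bool)%type})
    (A : set (set X)) (V : nat)
    (shat : n.-tuple (X * bool)%type -> X -> bool),
  (0 < n)%N ->
  regression_function P eta ->
  iid_copies P XY ->
  (forall B, A B -> measurable B) ->
  separable_class R (indicators A) ->
  vc_dimension A V ->
  (1 <= V)%N ->
  empirical_risk_minimizer R (indicators A) shat ->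
  indicators A (bayes_classifier eta) ->
  let sstar := bayes_classifier eta in
  let Eloss := 'E_Pr[fun w =>
    relative_loss P sstar (shat [tuple XY i w | i < n])]%E in
  let EH := fine 'E_Pr[fun w =>
    combinatorial_entropy R A (fun i => (XY i w).1)]%E in
  (Eloss <= (C * Num.sqrt (Num.min V%:R (Num.max 1 EH) / n%:R))%:E)%E /\
  forall theta h : R,
    1 <= theta ->
    0 < h -> h <= 1 ->
    (forall t, indicators A t ->
       h `^ theta * L1_dist P sstar t `^ theta <= relative_loss P sstar t) ->
    (V%:R / n%:R) `^ (2 * theta)^-1 <= h ->
    (Eloss <= (C * (Num.max 1 EH / (n%:R * h))
                     `^ (theta / (2 * theta - 1)))%:E)%E /\
    (Eloss <= (C * (V%:R * (1 + ln (n%:R * h `^ (2 * theta) / V%:R))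
                     / (n%:R * h)) `^ (theta / (2 * theta - 1)))%:E)%E.
Proof.
(* The largest constant comes from the fast VC rate: [r + 3600 * (2 r)]. *)
exists 7201 => d X P eta d0 Omega Pr n XY A V shat n0 _ iidXY mA sepA vcV V0 erm As s.
pose Q := distribution Pr (sample XY : {mfun Omega >-> n.-tuple (X * bool)%type}).
have iidQ : iid_law P Q := iid_copies_law iidXY.
have Q1 : Q setT = 1%E := probability_setT _.
have bl := bounded_measurable_erm_loss P Q s mA erm.
have bH := bounded_measurable_ln_card_traces n mA sepA.
move=> Eloss EH.
have -> : Eloss = (\int[Q]_z relative_loss P s (shat z))%:E.
  exact: (expectation_sample XY bl).
have -> : EH = \int[Q]_z ln #|traces A (points z)|%:R.
  rewrite /EH (_ : (fun _ => _) = fun w => ln #|traces A (points (sample XY w))|%:R).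
    by rewrite (expectation_sample XY bH).
  apply/funext => w; rewrite /combinatorial_entropy -card_traces.
  by congr (ln #|pred_of_set (traces A _)|%:R); apply/funext => i; rewrite /points tnth_mktuple.
set EL := \int[Q]_z relative_loss P s (shat z).
set H := \int[Q]_z ln _.
have ms : measurable_fun setT s := measurable_indicators mA As.
have EL1 : EL <= 1.
  rewrite -[leRHS](bm_Rintegral_cst Q1); apply: (bm_le_Rintegral Q1 bl).
    exact: bounded_measurable_cst.
  move=> z; apply: relative_loss_le1 => //.
  by apply: (measurable_indicators mA); case: erm.
set L := Num.max 1 H.
have L0 : 0 < L by rewrite lt_max ltr01.
have HL : H <= L by rewrite le_max lexx orbT.
have n0R : 0 < n%:R :> R by rewrite ltr0n.
have V0R : 0 < V%:R :> R by rewrite ltr0n.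
(* Without margin the offset costs at most [c], the L1 distance being at most 1. *)
have slow t (c : R) (c0 : 0 < c) : indicators A t ->
    2 * relative_loss P s t - c <= 2 * relative_loss P s t - c * L1_dist P s t.
  move=> At; rewrite lerD2l lerN2 ler_piMr ?(ltW c0)//.
  by apply: L1_dist_le1 => //; exact: measurable_indicators At.
have slowH : EL <= 7201 * Num.sqrt (L / n%:R).
  set c := Num.sqrt (L / n%:R).
  have c0 : 0 < c by rewrite sqrtr_gt0 divr_gt0.
  (* A rate above 1 is trivial since [EL <= 1]; otherwise it is an admissible offset. *)
  have [c1|/ltW c1] := leP c 1; last by move: EL1 c1; clear; lra.
  have := erm_entropy_bound iidQ mA As erm n0 c0 c1 (fun t => slow t c c0) sepA.
  rewrite -/EL -/H.
  have : H / (n%:R * c) <= c.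
    rewrite ler_pdivrMr ?mulr_gt0// mulrCA -expr2 sqr_sqrtr ?divr_ge0 ?(ltW L0)//.
    by rewrite mulrCA mulfV ?mulr1// gt_eqF.
  by move: c0; clear; lra.
have slowV : EL <= 7201 * Num.sqrt (V%:R / n%:R).
  set c := Num.sqrt (V%:R / n%:R).
  have c0 : 0 < c by rewrite sqrtr_gt0 divr_gt0.
  have [c1|/ltW c1] := leP c 1; last by move: EL1 c1; clear; lra.
  (* At this offset the logarithm in the VC bound vanishes. *)
  have cV : n%:R * c ^+ 2 = V%:R.
    by rewrite sqr_sqrtr ?divr_ge0// mulrCA mulfV ?mulr1// gt_eqF.
  have Vc : V%:R <= n%:R * c ^+ 2 by rewrite cV.
  have := erm_vc_bound iidQ mA As erm n0 c0 c1 (fun t => slow t c c0) vcV V0 Vc.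
  rewrite -/EL cV divff ?gt_eqF// ln1 addr0 mulr1.
  have : V%:R / (n%:R * c) <= c.
    by rewrite ler_pdivrMr ?mulr_gt0// mulrCA -expr2 cV.
  by move: c0; clear; lra.
split; first by rewrite lee_fin; case: (leP V%:R L).
move=> th h th1 h0 h1 margin hV.
(* The margin condition gives [c * L1_dist <= l + r], so one of the two copies of the loss pays for
   the offset. *)
have fast u : 0 < u -> fast_rate th h n%:R u <= 1 -> forall t, indicators A t ->
    1 * relative_loss P s t - fast_rate th h n%:R u <=
    2 * relative_loss P s t - offset_level th h n%:R u * L1_dist P s t.
  move=> u0 r1 t At.
  have := margin_linearized th1 h0 (fast_rate_gt0 th h0 n0R u0)
    (L1_dist_ge0 P s t) (margin t At).
  by rewrite -/(offset_level th h n%:R u); clear; lra.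
rewrite !lee_fin; split.
  rewrite -/(fast_rate th h n%:R L).
  have [r1|/ltW r1] := leP (fast_rate th h n%:R L) 1; last by move: EL1 r1; clear; lra.
  have c0 := offset_level_gt0 th h0 n0R L0.
  have c1 := offset_level_le1 th1 h0 h1 n0R L0 r1.
  have := erm_entropy_bound iidQ mA As erm n0 c0 c1 (fast L L0 r1) sepA.
  rewrite -/EL -/H mul1r.
  have : H / (n%:R * offset_level th h n%:R L) <= fast_rate th h n%:R L.
    rewrite -[leRHS](offset_level_rate th1 h0 n0R L0).
    by rewrite ler_wpM2r// invr_ge0 ltW// mulr_gt0.
  have := fast_rate_gt0 th h0 n0R L0; clear; lra.
(* The lower bound on [h], raised to the power [2 * th], reads [V / n <= h ^ (2 th)]. *)
have x1 : 0 <= ln (n%:R * h `^ (2 * th) / V%:R).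
  have t20 : 0 < 2 * th by rewrite mulr_gt0//; apply: lt_le_trans th1.
  have e : (V%:R / n%:R) `^ (2 * th)^-1 `^ (2 * th) = V%:R / n%:R :> R.
    by rewrite -powRrM mulVf ?(gt_eqF t20)// powRr1 ?divr_ge0.
  apply: ln_ge0; rewrite ler_pdivlMr// mul1r mulrC -ler_pdivrMr// -e.
  by apply: ge0_ler_powR; rewrite ?nnegrE ?powR_ge0 ?(ltW t20) ?(ltW h0).
set u := V%:R * _.
have u0 : 0 < u by rewrite mulr_gt0// ltr_pwDl.
rewrite -/(fast_rate th h n%:R u).
have [r1|/ltW r1] := leP (fast_rate th h n%:R u) 1; last by move: EL1 r1; clear; lra.
have c0 := offset_level_gt0 th h0 n0R u0.
have c1 := offset_level_le1 th1 h0 h1 n0R u0 r1.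
have [Vc lnc] := ln_offset_level_vc th1 h0 n0R V0R x1.
have := erm_vc_bound iidQ mA As erm n0 c0 c1 (fast u u0 r1) vcV V0 Vc.
rewrite -/EL mul1r -/u.
(* Passing from [h ^ (2 th)] to [c ^ 2] inside the logarithm costs at most a factor 2. *)
have : V%:R * (1 + ln (n%:R * offset_level th h n%:R u ^+ 2 / V%:R))
    / (n%:R * offset_level th h n%:R u) <= 2 * fast_rate th h n%:R u.
  rewrite -[fast_rate _ _ _ _](offset_level_rate th1 h0 n0R u0) mulrA.
  rewrite ler_wpM2r ?invr_ge0 ?(ltW (mulr_gt0 n0R c0))//.
  by have := ler_wpM2l (ltW V0R) lnc; rewrite [leRHS]mulrCA.
have := fast_rate_gt0 th h0 n0R u0; clear; lra.
Qed.
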